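(* Let $a$ and $b$ be real constants such that one of the following conditions holds: (1) $a=1$ and $1\leq b\leq 4$; (2) $1<a\leq b\leq\min\left\{3,\,1+a,\,\frac{4a}{5a-4}\right\}$. Then the function $f(z)=z\,{}_2F_1(a,b;a+b;z)$ is convex in $\mathbb{D}$, and it maps $\mathbb{D}$ into the strip domain bounded by the two horizontal lines $\operatorname{Im}w=\pm\frac{\pi}{2\mathrm{B}(a,b)}$, that is, $$|\operatorname{Im}f(z)|<\frac{\pi}{2\mathrm{B}(a,b)}\quad\text{for all }z\in\mathbb{D}.$$ The boundary lines are optimal: neither of the two lines can be replaced by a horizontal line bounding a smaller strip that still contains $f(\mathbb{D})$, i.e. $\sup_{z\in\mathbb{D}}\operatorname{Im}f(z)=\frac{\pi}{2\mathrm{B}(a,b)}$ and $\inf_{z\in\mathbb{D}}\operatorname{Im}f(z)=-\frac{\pi}{2\mathrm{B}(a,b)}$.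
   Context: $\mathbb{D}=\{z\in\mathbb{C}:|z|<1\}$. The Gaussian hypergeometric function is ${}_2F_1(a,b;c;z)=\sum_{n=0}^\infty\frac{(a)_n(b)_n}{(c)_n\,n!}z^n$ for $z\in\mathbb{D}$ (where $c\notin\{0,-1,-2,\dots\}$), with $(a)_0=1$ and $(a)_{n+1}=(a)_n(a+n)$. $\mathrm{B}(a,b)=\Gamma(a)\Gamma(b)/\Gamma(a+b)$ is the Beta function. A function $f$ analytic in $\mathbb{D}$ with $f(0)=0$ and $f'(0)=1$ is called convex in $\mathbb{D}$ if $f'$ has no zeros in $\mathbb{D}$ and $1+\inf_{z\in\mathbb{D}}\operatorname{Re}\frac{zf''(z)}{f'(z)}\geq 0$. Equivalently, $f$ is univalent in $\mathbb{D}$ and $f(\mathbb{D})$ is a convex domain. *)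

(* Defs.v *)
From Stdlib Require Import Reals Factorial.
From Coquelicot Require Import Coquelicot.
Local Open Scope R_scope.

Definition unit_disk (z : C) : Prop := Cmod z < 1.

(* Sum of a convergent complex series, taken componentwise; a junk value if
   the series diverges, as for [Series]. *)
Definition CSeries (u : nat -> C) : C :=
  (Series (fun n => Re (u n)), Series (fun n => Im (u n))).

Lemma is_series_CSeries (u : nat -> C) (l : C) :
  is_series u l -> CSeries u = l.
Proof.
  intros H.
  assert (Hs : forall n, Re (sum_n u n) = sum_n (fun k => Re (u k)) n
                      /\ Im (sum_n u n) = sum_n (fun k => Im (u k)) n).
  { induction n as [|n [IH1 IH2]].
    - now rewrite !sum_O.
    - rewrite !sum_Sn, <- IH1, <- IH2. now split. }
  unfold CSeries; rewrite (surjective_pairing l); f_equal;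
    apply is_series_unique; unfold is_series.
  - apply filterlim_ext with (fun n => Re (sum_n u n)); [intros n; apply Hs|].
    intros P [eps HP]. unfold filtermap.
    apply (H (fun w => P (Re w))). exists eps. intros w [Hw _]. now apply HP.
  - apply filterlim_ext with (fun n => Im (sum_n u n)); [intros n; apply Hs|].
    intros P [eps HP]. unfold filtermap.
    apply (H (fun w => P (Im w))). exists eps. intros w [_ Hw]. now apply HP.
Qed.

Fixpoint pochhammer (a : R) (n : nat) : R :=
  match n with
  | O => 1
  | S m => pochhammer a m * (a + INR m)
  end.

Definition hyp2F1 (a b c : R) (z : C) : C :=
  CSeries (fun n =>
    (RtoC (pochhammer a n * pochhammer b n / (pochhammer c n * INR (fact n)))
     * z ^ n)%C).

(* Euler's integral; meaningful for [0 < x] only. *)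
Definition Gamma (x : R) : R :=
  RInt_gen (fun t => Rpower t (x - 1) * exp (- t))
    (at_right 0) (Rbar_locally p_infty).

Definition Beta (a b : R) : R := Gamma a * Gamma b / Gamma (a + b).

Definition analytic_on_disk (f : C -> C) : Prop :=
  forall z : C, unit_disk z -> @ex_derive C_AbsRing C_NormedModule f z.

(* [C_derive] only takes a limit along the real direction; it is the complex
   derivative because [f], hence also its derivative, is holomorphic here.
   The infimum is taken in the extended reals, so it may be [m_infty]. *)
Definition convex_on_disk (f : C -> C) : Prop :=
  analytic_on_disk f /\
  f (RtoC 0) = RtoC 0 /\
  C_derive f (RtoC 0) = RtoC 1 /\
  (forall z : C, unit_disk z -> C_derive f z <> RtoC 0) /\
  Rbar_le (Finite 0)
    (Rbar_plus (Finite 1)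
       (Glb_Rbar (fun x : R => exists z : C, unit_disk z /\
          x = Re (z * C_derive (C_derive f) z / C_derive f z)%C))).

(* Main.v *)
Require Import Defs.
From Stdlib Require Import Reals Factorial Lra Lia Psatz.
From Coquelicot Require Import Coquelicot.
Local Open Scope R_scope.

(** Write [f(z) = z F(z)], [s = a + b - 2], [k = (a - 1)(b - 1) / s] and [G(z) = (1 - z) f'(z)].

    Convexity.  Both cases of the hypothesis give [a, b >= 1] and [5 a b <= 4 (a + b)], whence
    [4 k <= s] and [s (1 + 5 k) <= 3].  Comparing coefficients, [z G' + s G = s (1 + k z) F], which
    together with [G = (1 - z) (F + z F')] is a Riccati equation for [P = z G' / G].  On every ray
    from the origin one has [Re P > - r / (1 + r)] for [r = |z| > 0]: at a first zero of
    [(1 + r) Re (P / r) + 1] the equation forces this quantity to increase.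
    Hence [1 + Re (z f'' / f') = Re (1 / (1 - z)) + Re P >= (1 - r) / (1 + r)].

    Strip.  The coefficients [c_n] of [f'] increase to [L = 1 / B(a, b)], by
    [Gamma (n + x) ~ n^x Gamma n].  For [z = r e^(it)] with [0 <= t <= PI],
    [L arg (1 / (1 - z)) - Im f(z) = sum (L - c_n) r^(n+1) sin ((n+1) t) / (n+1)] is nonnegative by
    Abel summation and the Fejer-Jackson inequality, and small at [z = cos t e^(it)] as [t -> 0]
    because [L - c_n = O(1/n)]; [Im f(z) >= 0] since the coefficients of [f] are decreasing and
    convex. *)

(** * Complex power series with real coefficients *)

(** [P] makes sense only where [G] has no zero, which is not known in advance. So the barrier is
    multiplied by [|G|^2]: along a ray, [phi = (1 + r) Re (conj G * dG/dr) + |G|^2] is defined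
    everywhere, and [2 (1 + r) phi] is the derivative of [(1 + r)^2 |G|^2]. As long as [phi > 0] the
    latter stays at least 1, so [G] cannot vanish before the first zero of [phi]; the barrier and
    the zero-freeness of [f'] come out together.

    The factor [1 - z] takes out the growth [L / (1 - z)] of [f'] at 1. The barrier [- r / (1 + r)]
    is the minimum of [Re (z / (1 - z))] on [|z| = r]. It serves twice: it bounds the forcing term
    of the Riccati equation, and it is an amount that [Re (1 / (1 - z)) >= 1 / (1 + r)] can absorb
    for every [r < 1].

    Of the two constraints on [s] and [k], [4 k <= s] is AM-GM for [a - 1] and [b - 1], and
    [s (1 + 5 k) <= 3] is [5 a b <= 4 (a + b)] rewritten. Both are equalities at [a = b = 8/5], the
    source of the constants [3/10] (for [k]) and [9/25] (for [s k]). *)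

Definition CPS (a : nat -> R) (z : C) : C :=
  CSeries (fun n => (RtoC (a n) * z ^ n)%C).

Definition radius_ge_1 (a : nat -> R) : Prop := Rbar_le 1 (CV_radius a).

Lemma im_le_Cmod (z : C) : Rabs (Im z) <= Cmod z.
Proof. exact (Rle_trans _ _ _ (Rmax_r _ _) (Rmax_Cmod z)). Qed.

Lemma radius_abs_summable (a : nat -> R) (r : R) :
  radius_ge_1 a -> 0 <= r < 1 -> ex_series (fun n => Rabs (a n) * r ^ n).
Proof.
  intros Ha [H0 H1].
  apply ex_series_ext with (fun n => Rabs (a n * r ^ n)).
  - intros n. rewrite Rabs_mult. f_equal. apply Rabs_pos_eq, pow_le, H0.
  - apply CV_disk_inside. rewrite Rabs_pos_eq by exact H0.
    apply Rbar_lt_le_trans with 1; [exact H1 | exact Ha].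
Qed.

Lemma radius_of_bounded (a : nat -> R) (M : R) :
  (forall n, Rabs (a n) <= M) -> radius_ge_1 a.
Proof.
  intros H. apply (CV_radius_bounded a). exists M.
  intros n. now rewrite pow1, Rmult_1_r.
Qed.

Lemma radius_derive (a : nat -> R) : radius_ge_1 a -> radius_ge_1 (PS_derive a).
Proof. unfold radius_ge_1. now rewrite CV_radius_derive. Qed.

Lemma radius_incr_1 (a : nat -> R) : radius_ge_1 a -> radius_ge_1 (PS_incr_1 a).
Proof. unfold radius_ge_1. now rewrite CV_radius_incr_1. Qed.

Lemma radius_plus (a b : nat -> R) :
  radius_ge_1 a -> radius_ge_1 b -> radius_ge_1 (fun n => a n + b n).
Proof.
  unfold radius_ge_1. intros Ha Hb.
  apply Rbar_le_trans with (2 := CV_radius_plus a b).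
  now apply Rbar_min_case.
Qed.

Lemma radius_scal (c : R) (a : nat -> R) :
  radius_ge_1 a -> radius_ge_1 (fun n => c * a n).
Proof.
  intros Ha. destruct (Req_dec c 0) as [->|Hc].
  - apply radius_of_bounded with 0. intros n. rewrite Rmult_0_l, Rabs_R0. lra.
  - unfold radius_ge_1. change (Rbar_le 1 (CV_radius (PS_scal c a))).
    now rewrite CV_radius_scal.
Qed.

Lemma ex_series_dominated (u v : nat -> R) :
  (forall n, Rabs (u n) <= v n) -> ex_series v -> ex_series u.
Proof. exact (ex_series_le (K := R_AbsRing) (V := R_CompleteNormedModule) u v). Qed.

Lemma ex_Rseries_scal_l (c : R) (u : nat -> R) :
  ex_series u -> ex_series (fun n => c * u n).
Proof. exact (ex_series_scal (K := R_AbsRing) (V := R_NormedModule) c u). Qed.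

Lemma ex_Rseries_scal_r (c : R) (u : nat -> R) :
  ex_series u -> ex_series (fun n => u n * c).
Proof.
  intros H. apply ex_series_ext with (2 := ex_Rseries_scal_l c u H).
  intros n; apply Rmult_comm.
Qed.

Lemma ex_Rseries_plus (u v : nat -> R) :
  ex_series u -> ex_series v -> ex_series (fun n => u n + v n).
Proof. exact (ex_series_plus (K := R_AbsRing) (V := R_NormedModule) u v). Qed.

Lemma ex_Rseries_minus (u v : nat -> R) :
  ex_series u -> ex_series v -> ex_series (fun n => u n - v n).
Proof. exact (ex_series_minus (K := R_AbsRing) (V := R_NormedModule) u v). Qed.

Lemma Re_RtoC_mult (x : R) (z : C) : Re (RtoC x * z) = x * Re z.
Proof. destruct z; simpl; ring. Qed.

Lemma Im_RtoC_mult (x : R) (z : C) : Im (RtoC x * z) = x * Im z.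
Proof. destruct z; simpl; ring. Qed.

Lemma ex_series_CPS_Re (a : nat -> R) (z : C) :
  radius_ge_1 a -> unit_disk z -> ex_series (fun n => a n * Re (z ^ n)).
Proof.
  intros Ha Hz. apply ex_series_dominated with (fun n => Rabs (a n) * Cmod z ^ n).
  - intros n. rewrite Rabs_mult, <- Cmod_pow.
    apply Rmult_le_compat_l; [apply Rabs_pos|apply re_le_Cmod].
  - apply radius_abs_summable; auto. split; [apply Cmod_ge_0|exact Hz].
Qed.

Lemma ex_series_CPS_Im (a : nat -> R) (z : C) :
  radius_ge_1 a -> unit_disk z -> ex_series (fun n => a n * Im (z ^ n)).
Proof.
  intros Ha Hz. apply ex_series_dominated with (fun n => Rabs (a n) * Cmod z ^ n).
  - intros n. rewrite Rabs_mult, <- Cmod_pow.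
    apply Rmult_le_compat_l; [apply Rabs_pos|apply im_le_Cmod].
  - apply radius_abs_summable; auto. split; [apply Cmod_ge_0|exact Hz].
Qed.

Lemma Re_CPS (a : nat -> R) (z : C) :
  Re (CPS a z) = Series (fun n => a n * Re (z ^ n)).
Proof. apply Series_ext; intros n; apply Re_RtoC_mult. Qed.

Lemma Im_CPS (a : nat -> R) (z : C) :
  Im (CPS a z) = Series (fun n => a n * Im (z ^ n)).
Proof. apply Series_ext; intros n; apply Im_RtoC_mult. Qed.

Lemma C_ext (z w : C) : Re z = Re w -> Im z = Im w -> z = w.
Proof. apply injective_projections. Qed.

Lemma Re_plus (z w : C) : Re (z + w) = Re z + Re w.
Proof. reflexivity. Qed.
Lemma Im_plus (z w : C) : Im (z + w) = Im z + Im w.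
Proof. reflexivity. Qed.
Lemma Re_minus (z w : C) : Re (z - w) = Re z - Re w.
Proof. reflexivity. Qed.
Lemma Im_minus (z w : C) : Im (z - w) = Im z - Im w.
Proof. reflexivity. Qed.
Lemma Re_mult (z w : C) : Re (z * w) = Re z * Re w - Im z * Im w.
Proof. reflexivity. Qed.
Lemma Im_mult (z w : C) : Im (z * w) = Re z * Im w + Im z * Re w.
Proof. reflexivity. Qed.
Lemma Re_conj (z : C) : Re (Cconj z) = Re z.
Proof. reflexivity. Qed.
Lemma Im_conj (z : C) : Im (Cconj z) = - Im z.
Proof. reflexivity. Qed.

Lemma CPS_ext (a b : nat -> R) (z : C) :
  (forall n, a n = b n) -> CPS a z = CPS b z.
Proof.
  intros H. unfold CPS, CSeries. f_equal; apply Series_ext; intros n; now rewrite H.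
Qed.

Lemma CPS_plus (a b : nat -> R) (z : C) :
  radius_ge_1 a -> radius_ge_1 b -> unit_disk z ->
  CPS (fun n => a n + b n) z = (CPS a z + CPS b z)%C.
Proof.
  intros Ha Hb Hz. apply C_ext.
  - rewrite Re_plus, !Re_CPS, <- Series_plus by now apply ex_series_CPS_Re.
    apply Series_ext; intros n. ring.
  - rewrite Im_plus, !Im_CPS, <- Series_plus by now apply ex_series_CPS_Im.
    apply Series_ext; intros n. ring.
Qed.

Lemma CPS_scal (c : R) (a : nat -> R) (z : C) :
  CPS (fun n => c * a n) z = (RtoC c * CPS a z)%C.
Proof.
  apply C_ext.
  - rewrite Re_RtoC_mult, !Re_CPS, <- Series_scal_l.
    apply Series_ext; intros n. ring.
  - rewrite Im_RtoC_mult, !Im_CPS, <- Series_scal_l.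
    apply Series_ext; intros n. ring.
Qed.

Lemma CPS_incr_1 (a : nat -> R) (z : C) :
  radius_ge_1 a -> unit_disk z ->
  CPS (PS_incr_1 a) z = (z * CPS a z)%C.
Proof.
  intros Ha Hz.
  assert (Hr := ex_series_CPS_Re a z Ha Hz).
  assert (Hi := ex_series_CPS_Im a z Ha Hz).
  apply C_ext.
  - rewrite Re_mult, !Re_CPS, Im_CPS.
    rewrite Series_incr_1_aux by apply Rmult_0_l.
    rewrite <- !Series_scal_l, <- Series_minus.
    2, 3 : now apply ex_Rseries_scal_l.
    apply Series_ext; intros n. rewrite Cpow_S, Re_mult. simpl. ring.
  - rewrite Im_mult, !Im_CPS, Re_CPS.
    rewrite Series_incr_1_aux by apply Rmult_0_l.
    rewrite <- !Series_scal_l, <- Series_plus.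
    2, 3 : now apply ex_Rseries_scal_l.
    apply Series_ext; intros n. rewrite Cpow_S, Im_mult. simpl. ring.
Qed.

Lemma CPS_conj (a : nat -> R) (z : C) : CPS a (Cconj z) = Cconj (CPS a z).
Proof.
  apply C_ext.
  - rewrite Re_conj, !Re_CPS. apply Series_ext; intros n.
    now rewrite <- Cpow_conj.
  - rewrite Im_conj, !Im_CPS, <- Series_opp. apply Series_ext; intros n.
    rewrite <- Cpow_conj, Im_conj. ring.
Qed.

Lemma Series_head (u : nat -> R) : (forall n, u (S n) = 0) -> Series u = u 0%nat.
Proof.
  intros H. transitivity (Series (fun n => u 0%nat * 0 ^ n)).
  - apply Series_ext. intros [|n]; simpl; [ring|rewrite H; ring].
  - rewrite Series_scal_l, Series_geom by (rewrite Rabs_R0; lra). field.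
Qed.

Lemma CPS_0 (a : nat -> R) : CPS a 0 = RtoC (a 0%nat).
Proof.
  assert (H0 : forall n, (RtoC 0 ^ S n)%C = RtoC 0) by (intros n; simpl; ring).
  apply C_ext.
  - rewrite Re_CPS, Series_head; [simpl; ring|].
    intros n. rewrite H0. simpl. ring.
  - rewrite Im_CPS, Series_head; [simpl; ring|].
    intros n. rewrite H0. simpl. ring.
Qed.

(** Little-o differentiability with the derivative named. [ex_derive] over [C], the value of
    [C_derive], and real derivatives along rays are all extracted from this one form. *)
Definition holo (f : C -> C) (z l : C) : Prop :=
  forall eps : R, 0 < eps -> exists delta : R, 0 < delta /\
    forall w : C, Cmod (w - z) < delta ->
      Cmod (f w - f z - l * (w - z)) <= eps * Cmod (w - z).

(** The remainder [E n] satisfies [E (n + 1) = w * E n + n z^(n-1) (w - z)^2], and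
    [n^2 + n <= (n + 1)^2]. The factor [r ^ 2] stands on the left to avoid the exponent [n - 2]. *)
Lemma Cpow_taylor (w z : C) (r : R) (n : nat) :
  0 < r -> Cmod w <= r -> Cmod z <= r ->
  Cmod (w ^ n - z ^ n - RtoC (INR n) * z ^ pred n * (w - z)) * r ^ 2
    <= INR n ^ 2 * r ^ n * Cmod (w - z) ^ 2.
Proof.
  intros Hr Hw Hz.
  assert (Hd := Cmod_ge_0 (w - z)).
  induction n as [|n IH].
  - simpl. replace (1 - 1 - 0 * 1 * (w - z))%C with (RtoC 0) by ring.
    rewrite Cmod_0. lra.
  - replace (w ^ S n - z ^ S n - RtoC (INR (S n)) * z ^ pred (S n) * (w - z))%C
      with (w * (w ^ n - z ^ n - RtoC (INR n) * z ^ pred n * (w - z))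
            + RtoC (INR n) * z ^ pred n * (w - z) * (w - z))%C.
    2:{ rewrite S_INR, RtoC_plus. destruct n; simpl; ring. }
    set (E := (w ^ n - z ^ n - RtoC (INR n) * z ^ pred n * (w - z))%C) in *.
    assert (HE := Cmod_ge_0 E).
    assert (Hn := pos_INR n).
    (* [pred 0 = 0] makes the power 1 instead of [z^(-1)] at [n = 0]; the weight [INR n] then kills
       the term. *)
    assert (Hp : Cmod (z ^ pred n) * r <= r ^ n \/ INR n = 0).
    { destruct n as [|n]; [now right|left]. rewrite Cmod_pow. simpl.
      rewrite Rmult_comm. apply Rmult_le_compat_l; [lra|].
      apply pow_incr. split; [apply Cmod_ge_0|exact Hz]. }
    eapply Rle_trans.
    { apply Rmult_le_compat_r; [apply pow2_ge_0|].
      eapply Rle_trans; [apply Cmod_triangle|].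
      rewrite !Cmod_mult, Cmod_R, (Rabs_pos_eq (INR n)) by exact Hn.
      apply Rle_refl. }
    rewrite S_INR. simpl (r ^ S n).
    assert (Hrn : 0 <= r ^ n) by (apply pow_le; lra).
    assert (H1 : Cmod w * Cmod E * r ^ 2 <= r * (INR n ^ 2 * r ^ n * Cmod (w - z) ^ 2)).
    { apply Rle_trans with (r * (Cmod E * r ^ 2)).
      - rewrite Rmult_assoc. apply Rmult_le_compat_r; [|exact Hw].
        apply Rmult_le_pos; [exact HE|apply pow2_ge_0].
      - apply Rmult_le_compat_l; lra. }
    assert (H2 : INR n * Cmod (z ^ pred n) * Cmod (w - z) * Cmod (w - z) * r ^ 2
                 <= r * (INR n * r ^ n * Cmod (w - z) ^ 2)).
    { destruct Hp as [Hp|Hp].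
      - replace (INR n * Cmod (z ^ pred n) * Cmod (w - z) * Cmod (w - z) * r ^ 2)
          with (r * (INR n * (Cmod (z ^ pred n) * r) * Cmod (w - z) ^ 2)) by ring.
        apply Rmult_le_compat_l; [lra|].
        apply Rmult_le_compat_r; [apply pow2_ge_0|].
        now apply Rmult_le_compat_l.
      - rewrite Hp. lra. }
    assert (H3 : 0 <= r * r ^ n * Cmod (w - z) ^ 2).
    { repeat apply Rmult_le_pos; try lra. }
    nra.
Qed.

(** The weights [n^2] come from applying [x d/dx] twice, which does not shrink the disk of
    convergence. *)
Lemma ex_series_square_weight (a : nat -> R) (r : R) :
  radius_ge_1 a -> 0 < r < 1 ->
  ex_series (fun n => Rabs (a n) * (INR n ^ 2 * r ^ n)).
Proof.
  intros Ha Hr.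
  set (b := PS_incr_1 (PS_derive (PS_incr_1 (PS_derive a)))).
  assert (Hb : radius_ge_1 b)
    by (unfold b; now apply radius_incr_1, radius_derive, radius_incr_1, radius_derive).
  apply ex_series_ext with (2 := radius_abs_summable b r Hb (conj (Rlt_le _ _ (proj1 Hr)) (proj2 Hr))).
  intros [|n].
  - unfold b, PS_incr_1, zero. simpl. rewrite Rabs_R0. ring.
  - unfold b, PS_incr_1, PS_derive. rewrite !Rabs_mult.
    rewrite (Rabs_pos_eq (INR (S n))) by apply pos_INR. simpl. ring.
Qed.

(** Termwise differentiation: the remainders of the monomials are summed under the quadratic bound
    of [Cpow_taylor], on the disk whose radius [r] lies halfway between [|z|] and 1. *)
Lemma CPS_holo (a : nat -> R) (z : C) :
  radius_ge_1 a -> unit_disk z -> holo (CPS a) z (CPS (PS_derive a) z).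
Proof.
  intros Ha Hz. unfold unit_disk in Hz.
  set (r := (1 + Cmod z) / 2).
  assert (Hz0 := Cmod_ge_0 z).
  assert (Hr : 0 < r < 1) by (unfold r; lra).
  assert (Hzr : Cmod z < r) by (unfold r; lra).
  set (K := Series (fun n => Rabs (a n) * (INR n ^ 2 * r ^ n))).
  assert (HK := ex_series_square_weight a r Ha Hr).
  assert (HK0 : 0 <= K).
  { unfold K. replace 0 with (Series (fun _ : nat => 0 * 0)) by (rewrite Series_scal_l; ring).
    apply Series_le; [|exact HK].
    intros n. rewrite Rmult_0_l. split; [apply Rle_refl|]. apply Rmult_le_pos; [apply Rabs_pos|].
    apply Rmult_le_pos; [apply pow2_ge_0|apply pow_le; lra]. }
  intros eps Heps.
  (* The first bound keeps [w] in the disk of radius [r]; the second turns the total remainder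
     [2 K |w - z|^2 / r^2] into at most [eps |w - z|]. The 2 comes from bounding real and imaginary
     parts separately, the [+ 1] from the possibility [K = 0]. *)
  exists (Rmin (r - Cmod z) (eps * r ^ 2 / (2 * K + 1))).
  assert (Hr2 : 0 < r ^ 2) by (apply pow_lt; lra).
  split.
  { apply Rmin_glb_lt; [lra|]. apply Rdiv_lt_0_compat; [|lra].
    now apply Rmult_lt_0_compat. }
  intros w Hw.
  assert (Hw1 := Rlt_le_trans _ _ _ Hw (Rmin_l _ _)).
  assert (Hw2 := Rlt_le_trans _ _ _ Hw (Rmin_r _ _)).
  assert (Hwr : Cmod w <= r).
  { replace w with (z + (w - z))%C by ring.
    eapply Rle_trans; [apply Cmod_triangle|]. lra. }
  set (d := Cmod (w - z)) in *.
  assert (Hd : 0 <= d) by apply Cmod_ge_0.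
  set (u := fun n : nat =>
    (RtoC (a n) * (w ^ n - z ^ n - RtoC (INR n) * z ^ pred n * (w - z)))%C).
  assert (Hu : forall n, Cmod (u n) <= d ^ 2 / r ^ 2 * (Rabs (a n) * (INR n ^ 2 * r ^ n))).
  { intros n. unfold u. rewrite Cmod_mult, Cmod_R.
    assert (T := Cpow_taylor w z r n (proj1 Hr) Hwr (Rlt_le _ _ Hzr)).
    fold d in T.
    replace (d ^ 2 / r ^ 2 * (Rabs (a n) * (INR n ^ 2 * r ^ n)))
      with (Rabs (a n) * ((INR n ^ 2 * r ^ n * d ^ 2) / r ^ 2)) by (field; lra).
    apply Rmult_le_compat_l; [apply Rabs_pos|].
    apply Rmult_le_reg_r with (r ^ 2); [exact Hr2|].
    eapply Rle_trans; [exact T|]. right. field. lra. }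
  assert (HzD : unit_disk z) by exact Hz.
  assert (HwD : unit_disk w) by (unfold unit_disk; lra).
  assert (Ha' := radius_derive a Ha).
  assert (Hpart : (CPS a w - CPS a z - CPS (PS_derive a) z * (w - z))%C = CSeries u).
  (* The derivative series, reindexed so that its terms carry [a n] like those of the two other
     series; the added term at 0 vanishes through its factor [INR 0]. *)
  { set (h := fun n => (RtoC (INR n) * z ^ pred n)%C).
    assert (Hh : forall p : C -> R, p (RtoC 0) = 0 ->
        (forall x c, p (RtoC x * c)%C = x * p c) ->
        ex_series (fun n => PS_derive a n * p (z ^ n)%C) ->
        ex_series (fun n => a n * p (h n))
        /\ Series (fun n => PS_derive a n * p (z ^ n)%C) = Series (fun n => a n * p (h n))).
    { intros p Hp0 Hp Hs.
      assert (E : forall n, PS_derive a n * p (z ^ n)%C = a (S n) * p (h (S n))).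
      { intros n. unfold h, PS_derive. rewrite Hp. simpl pred. ring. }
      split.
      - apply ex_series_incr_1. apply ex_series_ext with (2 := Hs). exact E.
      - rewrite (Series_incr_1_aux (fun n => a n * p (h n))).
        + now apply Series_ext.
        + unfold h. rewrite Hp. simpl. ring. }
    destruct (Hh Re eq_refl Re_RtoC_mult (ex_series_CPS_Re _ z Ha' HzD)) as [XR ER].
    destruct (Hh Im eq_refl Im_RtoC_mult (ex_series_CPS_Im _ z Ha' HzD)) as [XI EI].
    rewrite <- Re_CPS in ER. rewrite <- Im_CPS in EI.
    apply C_ext.
    - rewrite !Re_minus, Re_mult, ER, EI, !Re_CPS.
      rewrite <- Series_minus by now apply ex_series_CPS_Re.
      rewrite <- !Series_scal_r.
      rewrite <- Series_minus by now apply ex_Rseries_scal_r.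
      rewrite <- Series_minus.
      2: now apply ex_Rseries_minus; apply ex_series_CPS_Re.
      2: now apply ex_Rseries_minus; apply ex_Rseries_scal_r.
      apply Series_ext; intros n. unfold u.
      rewrite Re_RtoC_mult, !Re_minus, Re_mult. unfold h. rewrite !Re_minus. ring.
    - rewrite !Im_minus, Im_mult, ER, EI, !Im_CPS.
      rewrite <- Series_minus by now apply ex_series_CPS_Im.
      rewrite <- !Series_scal_r.
      rewrite <- Series_plus by now apply ex_Rseries_scal_r.
      rewrite <- Series_minus.
      2: now apply ex_Rseries_minus; apply ex_series_CPS_Im.
      2: now apply ex_Rseries_plus; apply ex_Rseries_scal_r.
      apply Series_ext; intros n. unfold u.
      rewrite Im_RtoC_mult, !Im_minus, Im_mult. unfold h. rewrite !Re_minus, !Im_minus. ring. }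
  rewrite Hpart.
  assert (Hdom := ex_Rseries_scal_l (d ^ 2 / r ^ 2) _ HK).
  assert (HB : forall p : C -> R, (forall c, Rabs (p c) <= Cmod c) ->
     Rabs (Series (fun n => p (u n))) <= d ^ 2 / r ^ 2 * K).
  { intros p Hp. unfold K. rewrite <- Series_scal_l.
    assert (Hpu : forall n, Rabs (p (u n)) <= d ^ 2 / r ^ 2 * (Rabs (a n) * (INR n ^ 2 * r ^ n))).
    { intros n. eapply Rle_trans; [apply Hp|apply Hu]. }
    eapply Rle_trans; [apply Series_Rabs|].
    - apply ex_series_dominated with (2 := Hdom).
      intros n. rewrite Rabs_Rabsolu. apply Hpu.
    - apply Series_le; [|exact Hdom]. intros n. split; [apply Rabs_pos|apply Hpu]. }
  assert (B1 := HB Re re_le_Cmod). assert (B2 := HB Im im_le_Cmod).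
  assert (HC : Cmod (CSeries u) <= 2 * (d ^ 2 / r ^ 2 * K)).
  { replace (CSeries u) with (RtoC (Re (CSeries u)) + Ci * RtoC (Im (CSeries u)))%C.
    2:{ apply injective_projections; simpl; ring. }
    eapply Rle_trans; [apply Cmod_triangle|].
    rewrite Cmod_mult, Cmod_Ci, !Cmod_R.
    change (Rabs (Re (CSeries u))) with (Rabs (Series (fun n => Re (u n)))).
    change (Rabs (Im (CSeries u))) with (Rabs (Series (fun n => Im (u n)))). lra. }
  eapply Rle_trans; [exact HC|].
  assert (Hk : d * (2 * K + 1) <= eps * r ^ 2).
  { apply Rmult_le_reg_r with (/ (2 * K + 1)); [apply Rinv_0_lt_compat; lra|].
    rewrite Rmult_assoc, Rinv_r, Rmult_1_r by lra. unfold Rdiv in Hw2. lra. }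
  apply Rmult_le_reg_r with (r ^ 2); [exact Hr2|].
  replace (2 * (d ^ 2 / r ^ 2 * K) * r ^ 2) with (2 * d ^ 2 * K) by (field; lra).
  assert (d * (d * (2 * K + 1)) <= d * (eps * r ^ 2)) by now apply Rmult_le_compat_l.
  nra.
Qed.

(** * Complex differentiability *)

Lemma holo_ex_derive (f : C -> C) (z l : C) :
  holo f z l -> @ex_derive C_AbsRing C_NormedModule f z.
Proof.
  intros H. exists l. split; [apply is_linear_scal_l|].
  intros x Hx.
  apply (is_filter_lim_locally_unique (K := C_AbsRing) (V := AbsRing_NormedModule C_AbsRing)) in Hx.
  subst x. intros eps. destruct (H eps (cond_pos eps)) as [d [Hd Hw]].
  exists (mkposreal d Hd). intros w Hb.
  specialize (Hw w Hb).
  change (Cmod ((f w - f z) - (w - z) * l) <= eps * Cmod (w - z)).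
  now rewrite (Cmult_comm (w - z) l).
Qed.

Lemma holo_unit_ext (f g : C -> C) (z l : C) :
  unit_disk z -> (forall w, unit_disk w -> f w = g w) -> holo f z l -> holo g z l.
Proof.
  intros Hz E H eps Heps. destruct (H eps Heps) as [d [Hd Hw]].
  unfold unit_disk in Hz.
  exists (Rmin d (1 - Cmod z)). split; [apply Rmin_glb_lt; lra|].
  intros w Hwd.
  rewrite <- (E z Hz), <- (E w).
  - apply Hw. eapply Rlt_le_trans; [exact Hwd|apply Rmin_l].
  - assert (Hwd' := Rlt_le_trans _ _ _ Hwd (Rmin_r _ _)). unfold unit_disk.
    replace w with (z + (w - z))%C by ring.
    eapply Rle_lt_trans; [apply Cmod_triangle|]. lra.
Qed.

(** A real-linear functional of norm at most 1 is all that the estimate needs, so [Re] and [Im]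
    share one proof. *)
Lemma holo_ray (f : C -> C) (v l : C) (r : R) (p : C -> R) :
  (forall c, Rabs (p c) <= Cmod c) -> (forall c d, p (c - d)%C = p c - p d) ->
  (forall x c, p (RtoC x * c)%C = x * p c) ->
  holo f (RtoC r * v) l ->
  is_derive (fun x : R => p (f (RtoC x * v)%C)) r (p (l * v)%C).
Proof.
  intros Hp Hpm Hps H. apply is_derive_Reals. intros eps Heps.
  assert (HV := Cmod_ge_0 v).
  assert (He : 0 < eps / (2 * (Cmod v + 1))) by (apply Rdiv_lt_0_compat; lra).
  destruct (H _ He) as [d [Hd Hw]].
  assert (Hd' : 0 < d / (Cmod v + 1)) by (apply Rdiv_lt_0_compat; lra).
  exists (mkposreal _ Hd'). intros h Hh0 Hh. simpl in Hh.
  assert (Eh : (RtoC (r + h) * v - RtoC r * v)%C = (RtoC h * v)%C)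
    by (rewrite RtoC_plus; ring).
  assert (Hdist : Cmod (RtoC (r + h) * v - RtoC r * v) = Rabs h * Cmod v)
    by now rewrite Eh, Cmod_mult, Cmod_R.
  assert (Hah := Rabs_pos_lt h Hh0).
  specialize (Hw (RtoC (r + h) * v)%C). rewrite Hdist, Eh in Hw.
  assert (Hlt : Rabs h * Cmod v < d).
  { apply Rle_lt_trans with (Rabs h * (Cmod v + 1)); [nra|].
    apply Rmult_lt_reg_r with (/ (Cmod v + 1)); [apply Rinv_0_lt_compat; lra|].
    rewrite Rmult_assoc, Rinv_r, Rmult_1_r by lra. exact Hh. }
  specialize (Hw Hlt).
  assert (Hq := Rle_trans _ _ _ (Hp _) Hw).
  rewrite !Hpm in Hq.
  replace (l * (RtoC h * v))%C with (RtoC h * (l * v))%C in Hq by ring.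
  rewrite Hps in Hq.
  replace ((p (f (RtoC (r + h) * v)%C) - p (f (RtoC r * v)%C)) / h - p (l * v)%C)
    with ((p (f (RtoC (r + h) * v)%C) - p (f (RtoC r * v)%C) - h * p (l * v)%C) / h)
    by (field; exact Hh0).
  unfold Rdiv at 1. rewrite Rabs_mult, Rabs_inv.
  apply Rmult_lt_reg_r with (Rabs h); [exact Hah|].
  rewrite Rmult_assoc, Rinv_l, Rmult_1_r by lra.
  eapply Rle_lt_trans; [exact Hq|].
  apply Rle_lt_trans with (eps / 2 * Rabs h); [|nra].
  replace (eps / (2 * (Cmod v + 1)) * (Rabs h * Cmod v))
    with (eps / 2 * Rabs h * (Cmod v / (Cmod v + 1))) by (field; lra).
  rewrite <- (Rmult_1_r (eps / 2 * Rabs h)) at 2.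
  apply Rmult_le_compat_l; [nra|].
  apply Rmult_le_reg_r with (Cmod v + 1); [lra|].
  unfold Rdiv. rewrite Rmult_assoc, Rinv_l by lra. lra.
Qed.

Lemma holo_ray_Re (f : C -> C) (v l : C) (r : R) :
  holo f (RtoC r * v) l ->
  is_derive (fun x : R => Re (f (RtoC x * v)%C)) r (Re (l * v)%C).
Proof.
  apply holo_ray; [exact re_le_Cmod|reflexivity|exact Re_RtoC_mult].
Qed.

Lemma holo_ray_Im (f : C -> C) (v l : C) (r : R) :
  holo f (RtoC r * v) l ->
  is_derive (fun x : R => Im (f (RtoC x * v)%C)) r (Im (l * v)%C).
Proof.
  apply holo_ray; [exact im_le_Cmod|reflexivity|exact Im_RtoC_mult].
Qed.

Lemma holo_C_derive (f : C -> C) (z l : C) : holo f z l -> C_derive f z = l.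
Proof.
  intros H.
  assert (Hc : forall p : C -> R, (forall c, Rabs (p c) <= Cmod c) ->
      (forall c d, p (c - d)%C = p c - p d) ->
      is_lim (fun x : R => p ((f (x, snd z) - f z) / ((x, snd z) - z))%C) (fst z) (p l)).
  { intros p Hp Hpm. apply is_lim_spec. intros eps.
    destruct (H (eps / 2)) as [d [Hd Hw]]; [apply is_pos_div_2|].
    exists (mkposreal d Hd). intros x Hx Hne.
    change (Rabs (x - fst z) < d) in Hx.
    change (Rabs (p ((f (x, snd z) - f z) / ((x, snd z) - z))%C - p l) < eps).
    assert (Ew : ((x, snd z) - z)%C = RtoC (x - fst z)).
    { apply injective_projections; simpl; ring. }
    specialize (Hw (x, snd z)). rewrite Ew in Hw |- *. rewrite Cmod_R in Hw.
    specialize (Hw Hx).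
    assert (Hn0 : x - fst z <> 0) by (intros E; apply Hne; lra).
    assert (Hpos := Rabs_pos_lt _ Hn0).
    assert (HC0 : RtoC (x - fst z) <> RtoC 0) by (intros E; injection E; auto).
    rewrite <- Hpm.
    eapply Rle_lt_trans; [apply Hp|].
    replace ((f (x, snd z) - f z) / RtoC (x - fst z) - l)%C
      with ((f (x, snd z) - f z - l * RtoC (x - fst z)) / RtoC (x - fst z))%C
      by (field; exact HC0).
    rewrite Cmod_div, Cmod_R by exact HC0.
    apply Rmult_lt_reg_r with (Rabs (x - fst z)); [exact Hpos|].
    unfold Rdiv. rewrite Rmult_assoc, Rinv_l, Rmult_1_r by lra.
    eapply Rle_lt_trans; [exact Hw|]. assert (He := cond_pos eps). nra. }
  apply C_ext.
  - transitivity (real (Finite (Re l))); [|reflexivity].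
    exact (f_equal real (is_lim_unique _ _ _ (Hc Re re_le_Cmod (fun _ _ => eq_refl)))).
  - transitivity (real (Finite (Im l))); [|reflexivity].
    exact (f_equal real (is_lim_unique _ _ _ (Hc Im im_le_Cmod (fun _ _ => eq_refl)))).
Qed.

(** * The Taylor coefficients *)

Definition hyp_coef (a b : R) (n : nat) : R :=
  pochhammer a n * pochhammer b n / (pochhammer (a + b) n * INR (fact n)).

Definition der_coef (a b : R) (n : nat) : R := INR (S n) * hyp_coef a b n.

(* Coefficients of [(1 - z) f'(z)]. *)
Definition diff_coef (a b : R) (n : nat) : R :=
  match n with
  | O => 1
  | S m => der_coef a b (S m) - der_coef a b m
  end.

Lemma pochhammer_pos (x : R) (n : nat) : 0 < x -> 0 < pochhammer x n.
Proof.
  intros Hx. induction n as [|n IH]; simpl; [lra|].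
  assert (H := pos_INR n). apply Rmult_lt_0_compat; lra.
Qed.

(* With [s = a + b - 2] and [q = (a - 1)(b - 1)] the last condition reads [s + 5 q <= 3]. *)
Definition admissible (a b : R) : Prop :=
  1 <= a /\ 1 <= b /\ 5 * (a * b) <= 4 * (a + b).

Section Coefficients.
Variables a b : R.
Hypothesis Hab : admissible a b.

Let Ha : 1 <= a. Proof. apply Hab. Qed.
Let Hb : 1 <= b. Proof. apply Hab. Qed.
Let H5 : 5 * (a * b) <= 4 * (a + b). Proof. apply Hab. Qed.

Lemma hyp_coef_pos (n : nat) : 0 < hyp_coef a b n.
Proof.
  unfold hyp_coef. apply Rdiv_lt_0_compat; apply Rmult_lt_0_compat;
    try (apply pochhammer_pos; lra). apply INR_fact_lt_0.
Qed.

Lemma hyp_coef_S (n : nat) :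
  hyp_coef a b (S n) * ((a + b + INR n) * (INR n + 1))
  = hyp_coef a b n * ((a + INR n) * (b + INR n)).
Proof.
  unfold hyp_coef. change (fact (S n)) with (S n * fact n)%nat.
  rewrite mult_INR, S_INR. simpl pochhammer.
  assert (H := pos_INR n). assert (Hf := INR_fact_lt_0 n).
  assert (Hp : 0 < pochhammer (a + b) n) by (apply pochhammer_pos; lra).
  field. repeat split; lra.
Qed.

Lemma hyp_coef_decr (n : nat) : hyp_coef a b (S n) <= hyp_coef a b n.
Proof.
  assert (H := hyp_coef_S n). assert (Hn := pos_INR n).
  assert (Hp := hyp_coef_pos n).
  assert (HD : 0 < (a + b + INR n) * (INR n + 1)) by (apply Rmult_lt_0_compat; lra).
  apply Rmult_le_reg_r with (1 := HD). rewrite H.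
  apply Rmult_le_compat_l; nra.
Qed.

Lemma hyp_coef_0 : hyp_coef a b 0 = 1.
Proof. unfold hyp_coef. simpl. field. Qed.

Lemma hyp_coef_le_1 (n : nat) : hyp_coef a b n <= 1.
Proof.
  induction n as [|n IH]; [rewrite hyp_coef_0; lra|].
  assert (H := hyp_coef_decr n). lra.
Qed.

(** With [s] and [q] as in the proof, AM-GM gives [4 q <= s^2], while [s <= 3 - 5 q]. If [q > 9/25],
    then [s < 6/5], so [s^2 < 36/25 < 4 q]. *)
Lemma excess_le : (a - 1) * (b - 1) <= 9 / 25.
Proof.
  assert (0 <= (a - 1) * (b - 1)) by (apply Rmult_le_pos; lra).
  set (q := (a - 1) * (b - 1)) in *. set (s := a + b - 2).
  assert (s + 5 * q <= 3) by (unfold s, q; lra).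
  assert (4 * q <= s ^ 2).
  { assert (Hsq := pow2_ge_0 (a - b)). unfold s, q. lra. }
  assert (0 <= s) by (unfold s; lra).
  destruct (Rle_or_lt q (9 / 25)); [assumption|exfalso].
  assert (s < 6 / 5) by lra. nra.
Qed.

(** The recurrence expresses both neighbours as multiples of the middle coefficient, which leaves a
    rational inequality in [x = n]. *)
Lemma hyp_coef_convex (n : nat) :
  2 * hyp_coef a b (S n) <= hyp_coef a b n + hyp_coef a b (S (S n)).
Proof.
  assert (H1 := hyp_coef_S n). assert (H2 := hyp_coef_S (S n)).
  rewrite S_INR in H2. assert (Hn := pos_INR n).
  assert (Hp := hyp_coef_pos n). assert (Hp1 := hyp_coef_pos (S n)).
  set (x := INR n) in *.
  set (A0 := hyp_coef a b n) in *. set (A1 := hyp_coef a b (S n)) in *.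
  set (A2 := hyp_coef a b (S (S n))) in *.
  assert (Hq := excess_le).
  assert (HD1 : 0 < (a + b + x) * (x + 1)) by (apply Rmult_lt_0_compat; lra).
  assert (HD2 : 0 < (a + b + (x + 1)) * (x + 1 + 1)) by (apply Rmult_lt_0_compat; lra).
  assert (HN : 0 < (a + x) * (b + x)) by (apply Rmult_lt_0_compat; lra).
  assert (E0 : A0 = A1 * ((a + b + x) * (x + 1)) / ((a + x) * (b + x))).
  { rewrite H1. field. split; lra. }
  assert (E2 : A2 = A1 * ((a + (x + 1)) * (b + (x + 1))) / ((a + b + (x + 1)) * (x + 1 + 1))).
  { rewrite <- H2. field. split; lra. }
  rewrite E0, E2.
  assert (HK : 0 <= ((a + b + x) * (x + 1)) / ((a + x) * (b + x))
      + ((a + (x + 1)) * (b + (x + 1))) / ((a + b + (x + 1)) * (x + 1 + 1)) - 2).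
  { replace (((a + b + x) * (x + 1)) / ((a + x) * (b + x))
      + ((a + (x + 1)) * (b + (x + 1))) / ((a + b + (x + 1)) * (x + 1 + 1)) - 2)
    with ((((a + b + x) * (x + 1) - (a + x) * (b + x)) * ((a + b + (x + 1)) * (x + 1 + 1))
       - ((a + b + (x + 1)) * (x + 1 + 1) - (a + (x + 1)) * (b + (x + 1))) * ((a + x) * (b + x)))
       / (((a + x) * (b + x)) * ((a + b + (x + 1)) * (x + 1 + 1)))).
    2:{ field. repeat split; lra. }
    apply Rdiv_le_0_compat; [|now apply Rmult_lt_0_compat].
    set (q := (a - 1) * (b - 1)) in *.
    set (s := a + b - 2).
    assert (0 <= q) by (apply Rmult_le_pos; lra).
    assert (0 <= s) by (unfold s; lra).
    replace ((a + b + x) * (x + 1) - (a + x) * (b + x)) with (x + 1 - q) by (unfold q; ring).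
    replace ((a + b + (x + 1)) * (x + 1 + 1) - (a + (x + 1)) * (b + (x + 1)))
      with (x + 2 - q) by (unfold q; ring).
    replace (a + b + (x + 1)) with (x + s + 3) by (unfold s; ring).
    replace ((a + x) * (b + x)) with (x * x + (s + 2) * x + 1 + s + q) by (unfold q, s; ring).
    assert (Hs : s + 5 * q <= 3) by (unfold s, q; lra).
    replace ((x + 1 - q) * ((x + s + 3) * (x + 1 + 1)) - (x + 2 - q) * (x * x + (s + 2) * x + 1 + s + q))
      with (2 * (x * x) + x * (6 - 4 * q) + (4 - q * s - 7 * q + q * q)) by ring.
    (* With [q <= 9/25] and [s <= 3], the constant term is at least [4 - 27/25 - 63/25 > 0]. *)
    assert (0 <= x * (6 - 4 * q)) by (apply Rmult_le_pos; lra).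
    assert (q * s <= 9 / 25 * 3) by (apply Rmult_le_compat; lra).
    nra. }
  set (Y := ((a + b + x) * (x + 1)) / ((a + x) * (b + x))) in *.
  set (Z := ((a + (x + 1)) * (b + (x + 1))) / ((a + b + (x + 1)) * (x + 1 + 1))) in *.
  replace (A1 * ((a + b + x) * (x + 1)) / ((a + x) * (b + x))) with (A1 * Y) by (unfold Y, Rdiv; ring).
  replace (A1 * ((a + (x + 1)) * (b + (x + 1))) / ((a + b + (x + 1)) * (x + 1 + 1))) with (A1 * Z)
    by (unfold Z, Rdiv; ring).
  nra.
Qed.

(** In [(n + 2)(a + n)(b + n) - (n + 1)^2 (a + b + n)] the cubic and quadratic terms cancel. What
    remains is linear with nonnegative coefficients, whence both the monotonicity of [der_coef] and
    its increments of order [1/n^2]. *)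
Lemma diff_coef_S (n : nat) :
  diff_coef a b (S n) * ((INR n + 1) * (a + b + INR n))
  = hyp_coef a b n * ((a * b - 1) * (INR n + 1) + (a - 1) * (b - 1)).
Proof.
  unfold diff_coef, der_coef.
  assert (H := hyp_coef_S n). rewrite !S_INR.
  replace (((INR n + 1 + 1) * hyp_coef a b (S n) - (INR n + 1) * hyp_coef a b n)
           * ((INR n + 1) * (a + b + INR n)))
    with ((INR n + 1 + 1) * (hyp_coef a b (S n) * ((a + b + INR n) * (INR n + 1)))
          - (INR n + 1) * hyp_coef a b n * ((INR n + 1) * (a + b + INR n))) by ring.
  rewrite H. ring.
Qed.

Lemma diff_coef_ge_0 (n : nat) : 0 <= diff_coef a b n.
Proof.
  destruct n as [|n]; [simpl; lra|].
  assert (H := diff_coef_S n). assert (Hn := pos_INR n). assert (Hp := hyp_coef_pos n).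
  assert (HD : 0 < (INR n + 1) * (a + b + INR n)) by (apply Rmult_lt_0_compat; lra).
  apply Rmult_le_reg_r with (1 := HD). rewrite H, Rmult_0_l.
  apply Rmult_le_pos; [lra|].
  assert (0 <= (a - 1) * (b - 1)) by (apply Rmult_le_pos; lra).
  assert (0 <= a * b - 1) by nra. nra.
Qed.

Lemma der_coef_incr (n : nat) : der_coef a b n <= der_coef a b (S n).
Proof. assert (H := diff_coef_ge_0 (S n)). simpl in H. lra. Qed.

(** The bound is written as a telescoping difference so that it sums to a defect of order [1/n]. The
    constant comes from [(a b - 1)(n + 1) + (a - 1)(b - 1) <= 2 a b (n + 1)], and
    [(n + 1) hyp_coef a b n <= L]. *)
Lemma der_coef_increment (L : R) (n : nat) :
  der_coef a b n <= L ->
  der_coef a b (S n) - der_coef a b n <= 2 * (a * b) * L * (/ (INR n + 1) - / (INR n + 2)).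
Proof.
  intros HL. change (der_coef a b (S n) - der_coef a b n) with (diff_coef a b (S n)).
  assert (H := diff_coef_S n). assert (Hn := pos_INR n). assert (Hp := hyp_coef_pos n).
  assert (HD : 0 < (INR n + 1) * (a + b + INR n)) by (apply Rmult_lt_0_compat; lra).
  unfold der_coef in HL. rewrite S_INR in HL. set (x := INR n) in *.
  apply Rmult_le_reg_r with (1 := HD). rewrite H.
  replace (2 * (a * b) * L * (/ (x + 1) - / (x + 2)) * ((x + 1) * (a + b + x)))
    with (2 * (a * b) * L * ((a + b + x) / (x + 2))) by (field; lra).
  assert (0 <= (a - 1) * (b - 1)) by (apply Rmult_le_pos; lra).
  assert (0 <= a * b - 1) by nra.
  apply Rle_trans with (2 * (a * b) * ((x + 1) * hyp_coef a b n)).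
  - replace (2 * (a * b) * ((x + 1) * hyp_coef a b n))
      with (hyp_coef a b n * (2 * (a * b) * (x + 1))) by ring.
    apply Rmult_le_compat_l; [lra|].
    assert ((a - 1) * (b - 1) <= a * b) by nra. nra.
  - rewrite <- (Rmult_1_r (2 * (a * b) * ((x + 1) * hyp_coef a b n))).
    assert (1 <= (a + b + x) / (x + 2)).
    { apply Rmult_le_reg_r with (x + 2); [lra|]. unfold Rdiv.
      rewrite Rmult_assoc, Rinv_l by lra. lra. }
    apply Rmult_le_compat; try lra.
    + apply Rmult_le_pos; [nra|]. apply Rmult_le_pos; lra.
    + apply Rmult_le_compat_l; [nra|exact HL].
Qed.

Lemma radius_hyp_coef : radius_ge_1 (hyp_coef a b).
Proof.
  apply radius_of_bounded with 1. intros n.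
  rewrite Rabs_pos_eq by (apply Rlt_le, hyp_coef_pos). apply hyp_coef_le_1.
Qed.

Lemma radius_der_coef : radius_ge_1 (der_coef a b).
Proof.
  change (radius_ge_1 (PS_derive (PS_incr_1 (hyp_coef a b)))).
  apply radius_derive, radius_incr_1, radius_hyp_coef.
Qed.

Lemma diff_coef_decomp (n : nat) :
  diff_coef a b n = der_coef a b n + -1 * PS_incr_1 (der_coef a b) n.
Proof.
  destruct n as [|n]; simpl; [|ring].
  unfold der_coef. rewrite hyp_coef_0. unfold zero; simpl. ring.
Qed.

Lemma radius_diff_coef : radius_ge_1 (diff_coef a b).
Proof.
  unfold radius_ge_1. rewrite (CV_radius_ext _ _ diff_coef_decomp).
  apply radius_plus; [apply radius_der_coef|].
  apply radius_scal, radius_incr_1, radius_der_coef.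
Qed.

Lemma CPS_diff_coef (z : C) : unit_disk z ->
  CPS (diff_coef a b) z = ((1 - z) * CPS (der_coef a b) z)%C.
Proof.
  intros Hz. rewrite (CPS_ext _ _ _ diff_coef_decomp).
  rewrite CPS_plus; [|apply radius_der_coef|apply radius_scal, radius_incr_1, radius_der_coef|exact Hz].
  rewrite CPS_scal, CPS_incr_1 by (auto using radius_der_coef).
  replace (RtoC (-1)) with (- (1))%C by (apply C_ext; simpl; ring). ring.
Qed.

Lemma CPS_der_coef (z : C) : unit_disk z ->
  CPS (der_coef a b) z
  = (CPS (hyp_coef a b) z + z * CPS (PS_derive (hyp_coef a b)) z)%C.
Proof.
  intros Hz.
  rewrite (CPS_ext (der_coef a b)
    (fun n => hyp_coef a b n + PS_incr_1 (PS_derive (hyp_coef a b)) n)).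
  - rewrite CPS_plus, CPS_incr_1; auto using radius_hyp_coef, radius_derive, radius_incr_1.
  - intros [|n]; unfold der_coef, PS_incr_1, PS_derive, zero.
    + simpl; ring.
    + rewrite !S_INR. ring.
Qed.

(** On coefficients this reads [(n + s) g_n = s (A_n + k A_(n-1))]. After multiplication by the
    denominator of the recurrence it becomes a polynomial identity, since [s k] is
    [(a - 1)(b - 1)]. *)
Lemma CPS_diff_coef_theta (k : R) (z : C) :
  k * (a + b - 2) = (a - 1) * (b - 1) -> unit_disk z ->
  (z * CPS (PS_derive (diff_coef a b)) z + RtoC (a + b - 2) * CPS (diff_coef a b) z)%C
  = (RtoC (a + b - 2) * (1 + RtoC k * z) * CPS (hyp_coef a b) z)%C.
Proof.
  intros Hk Hz. set (s := a + b - 2) in *.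
  assert (R1 := radius_hyp_coef). assert (R2 := radius_diff_coef).
  transitivity (CPS (fun n => PS_incr_1 (PS_derive (diff_coef a b)) n + s * diff_coef a b n) z).
  { rewrite CPS_plus, CPS_incr_1, CPS_scal;
      auto using radius_derive, radius_incr_1, radius_scal. }
  transitivity (CPS (fun n => s * hyp_coef a b n + (s * k) * PS_incr_1 (hyp_coef a b) n) z).
  2:{ rewrite CPS_plus, !CPS_scal, CPS_incr_1;
      auto using radius_derive, radius_incr_1, radius_scal.
      rewrite RtoC_mult. ring. }
  apply CPS_ext. intros [|n].
  - unfold PS_incr_1, zero. simpl. rewrite hyp_coef_0. ring.
  - unfold PS_incr_1, PS_derive.
    assert (H1 := hyp_coef_S n). assert (H2 := diff_coef_S n).
    assert (Hn := pos_INR n). assert (Hp := hyp_coef_pos n).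
    rewrite S_INR.
    set (x := INR n) in *. set (A0 := hyp_coef a b n) in *.
    set (A1 := hyp_coef a b (S n)) in *. set (g := diff_coef a b (S n)) in *.
    assert (HD : 0 < (a + b + x) * (x + 1)) by (apply Rmult_lt_0_compat; lra).
    apply Rmult_eq_reg_r with ((a + b + x) * (x + 1)); [|lra].
    replace (((x + 1) * g + s * g) * ((a + b + x) * (x + 1)))
      with ((x + 1 + s) * (g * ((x + 1) * (a + b + x)))) by ring.
    rewrite H2.
    replace ((s * A1 + s * k * A0) * ((a + b + x) * (x + 1)))
      with (s * (A1 * ((a + b + x) * (x + 1))) + (k * s) * A0 * ((a + b + x) * (x + 1))) by ring.
    rewrite H1, Hk. unfold s. ring.
Qed.

End Coefficients.

(** * The barrier inequality *)

Section Barrier.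
Variables s k r : R.
Hypothesis Hk : 0 <= k.
Hypothesis Hks : 4 * k <= s.
Hypothesis Hs : s * (1 + 5 * k) <= 3.
Hypothesis Hr : 0 < r < 1.

(** The two constraints give [4 k (1 + 5 k) <= 3], with equality at [3/10]. *)
Lemma barrier_k_le : k <= 3 / 10.
Proof. destruct (Rle_or_lt k (3 / 10)); [assumption|exfalso; nra]. Qed.

Lemma barrier_sk_le : s * k <= 9 / 25.
Proof.
  assert (H := barrier_k_le).
  apply Rmult_le_reg_r with (1 + 5 * k); [lra|].
  replace (s * k * (1 + 5 * k)) with (k * (s * (1 + 5 * k))) by ring. nra.
Qed.

(* The expression decreases in [s], so the worst case is [s = 3 / (1 + 5 k)]. *)
Lemma barrier_left_end :
  0 < (r / (1 + r)) * (2 - s * k - 2 * (r / (1 + r)))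
      - (s - r / (1 + r)) * (k * r / (1 - k * r)).
Proof.
  assert (H := barrier_k_le).
  assert (Hkr : 0 <= k * r <= 3 / 10) by (split; nra).
  replace ((r / (1 + r)) * (2 - s * k - 2 * (r / (1 + r)))
      - (s - r / (1 + r)) * (k * r / (1 - k * r)))
    with (r * ((2 - s * k * (1 + r)) * (1 - k * r) - k * (1 + r) * (s + (s - 1) * r))
          / ((1 + r) ^ 2 * (1 - k * r))) by (field; lra).
  apply Rdiv_lt_0_compat.
  2:{ apply Rmult_lt_0_compat; [apply pow_lt|]; lra. }
  apply Rmult_lt_0_compat; [lra|].
  apply Rmult_lt_reg_r with (1 + 5 * k); [lra|]. rewrite Rmult_0_l.
  assert (Hc1 : 0 <= k * (1 + r) * (1 - k * r) + k * (1 + r) ^ 2).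
  { apply Rplus_le_le_0_compat; repeat apply Rmult_le_pos; try lra; try (apply pow2_ge_0). }
  assert (E : ((2 - s * k * (1 + r)) * (1 - k * r) - k * (1 + r) * (s + (s - 1) * r)) * (1 + 5 * k)
    = (2 + 4 * k - r * (10 * k + 2 * k ^ 2) + r ^ 2 * (8 * k ^ 2 - 2 * k))
      + (3 - s * (1 + 5 * k)) * (k * (1 + r) * (1 - k * r) + k * (1 + r) ^ 2)) by ring.
  rewrite E.
  assert (0 <= (3 - s * (1 + 5 * k)) * (k * (1 + r) * (1 - k * r) + k * (1 + r) ^ 2))
    by (apply Rmult_le_pos; lra).
  assert (Hr1 : r * (10 * k + 2 * k ^ 2) <= 10 * k + 2 * k ^ 2) by nra.
  assert (Hr2 : 0 <= r ^ 2 <= 1) by (split; nra).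
  (* If the coefficient of [r^2] is nonnegative, dropping it leaves at least [2 - 6 k - 2 k^2].
     Otherwise the worst value is at [r = 1], namely [2 (1 - k)(1 - 3 k)]. Both are positive for
     [k <= 3/10]. *)
  destruct (Rle_or_lt 0 (8 * k ^ 2 - 2 * k)) as [Hp|Hp].
  - assert (0 <= r ^ 2 * (8 * k ^ 2 - 2 * k)) by (apply Rmult_le_pos; lra). nra.
  - assert (8 * k ^ 2 - 2 * k <= r ^ 2 * (8 * k ^ 2 - 2 * k)) by nra. nra.
Qed.

(** Crude bounds suffice at this end: the left side is at most [0.66^2 r], and since
    [r/2 <= rho <= 1/2] the right side is at least [4 rho (1 - 9/25 - 3/10) >= 0.68 r]. *)
Lemma barrier_right_end :
  (2 * (k * r) / (1 - (k * r) ^ 2)) ^ 2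
  < 4 * ((r / (1 + r)) * (2 - s * k - 2 * (r / (1 + r)))
         + (s - r / (1 + r)) * (k * r / (1 + k * r))).
Proof.
  assert (H := barrier_k_le). assert (Hsk := barrier_sk_le).
  set (rho := r / (1 + r)). set (t := k * r).
  assert (Ht : 0 <= t <= 3 / 10 * r) by (unfold t; split; nra).
  assert (Hrho : r / 2 <= rho <= 1 / 2).
  { unfold rho. split.
    - apply Rmult_le_reg_r with (1 + r); [lra|]. unfold Rdiv at 2.
      rewrite Rmult_assoc, Rinv_l by lra. nra.
    - apply Rmult_le_reg_r with (1 + r); [lra|]. unfold Rdiv at 1.
      rewrite Rmult_assoc, Rinv_l by lra. lra. }
  assert (Hq : 0 <= t / (1 + t) <= t).
  { split; [apply Rdiv_le_0_compat; lra|].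
    apply Rmult_le_reg_r with (1 + t); [lra|]. unfold Rdiv.
    rewrite Rmult_assoc, Rinv_l by lra. nra. }
  set (x := t / (1 + t)) in *.
  assert (HD : 0 <= 2 * t / (1 - t ^ 2) <= 66 / 100 * r).
  { assert (0 <= t ^ 2 <= 9 / 100) by (split; nra).
    split; [apply Rdiv_le_0_compat; lra|].
    apply Rmult_le_reg_r with (1 - t ^ 2); [lra|]. unfold Rdiv at 1.
    rewrite Rmult_assoc, Rinv_l by lra. nra. }
  set (d := 2 * t / (1 - t ^ 2)) in *.
  assert (d ^ 2 <= (66 / 100 * r) ^ 2) by (apply pow_incr; lra).
  assert (d ^ 2 <= (66 / 100) ^ 2 * r) by nra.
  assert (0 <= s * x) by (apply Rmult_le_pos; lra).
  assert (rho * x <= rho * (3 / 10)) by (apply Rmult_le_compat_l; lra).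
  assert (rho * (1 - 9 / 25) <= rho * (2 - s * k - 2 * rho)) by (apply Rmult_le_compat_l; lra).
  lra.
Qed.

(* Here [X + i W] stands for [k z / (1 + k z)] with [|z| = r] and [y] for [Im P].  Minimising over
   [y] leaves [W ^ 2 / 4], a product [u v / 4] where [u] and [v] are the distances from [X] to the
   ends of its range; bounding it linearly in [X] reduces the claim to these ends. *)
Lemma barrier_ineq (X W y : R) :
  X ^ 2 + W ^ 2 = (k * r) ^ 2 * ((1 - X) ^ 2 + W ^ 2) ->
  0 < y ^ 2 - y * W + (s - r / (1 + r)) * X
      + (r / (1 + r)) * (2 - s * k - 2 * (r / (1 + r))).
Proof.
  intros HX.
  assert (H := barrier_k_le). assert (HL := barrier_left_end). assert (HR := barrier_right_end).
  set (rho := r / (1 + r)) in *. set (t := k * r) in *.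
  assert (Ht : 0 <= t <= 3 / 10) by (unfold t; split; nra).
  assert (Ht2 : 0 <= t ^ 2 <= 9 / 100) by (split; nra).
  set (u := X + t / (1 - t)). set (v := t / (1 + t) - X).
  (* The hypothesis [|E| = t |1 - E|] on [E = X + i W] describes a circle with real diameter from
     [- t / (1 - t)] to [t / (1 + t)], so the squared height is the product of the two segments of
     the diameter. *)
  assert (Huv : W ^ 2 = u * v).
  { unfold u, v. apply Rmult_eq_reg_r with (1 - t ^ 2); [|lra].
    replace ((X + t / (1 - t)) * (t / (1 + t) - X) * (1 - t ^ 2))
      with ((X * (1 - t) + t) * (t - X * (1 + t))) by (field; lra).
    replace (W ^ 2 * (1 - t ^ 2)) with ((X ^ 2 + W ^ 2) - t ^ 2 * W ^ 2 - X ^ 2) by ring.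
    rewrite HX. ring. }
  assert (Hsum : u + v = 2 * t / (1 - t ^ 2)).
  { unfold u, v. field. split; [|split]; nra. }
  assert (Hsum0 : 0 <= u + v) by (rewrite Hsum; apply Rdiv_le_0_compat; lra).
  assert (HW0 := pow2_ge_0 W). rewrite Huv in HW0.
  assert (Hu : 0 <= u) by nra. assert (Hv : 0 <= v) by nra.
  rewrite <- Hsum in HR.
  set (c := rho * (2 - s * k - 2 * rho)) in *.
  assert (HXu : X = u - t / (1 - t)) by (unfold u; ring).
  assert (HXv : X = t / (1 + t) - v) by (unfold v; ring).
  assert (J0 : 0 < (s - rho) * X + c - (s - rho) * u) by (rewrite HXu; lra).
  assert (J1 : (u + v) ^ 2 < 4 * ((s - rho) * X + c + (s - rho) * v)) by (rewrite HXv; lra).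
  (* Adding [u] times [J1] and [4 v] times [J0] cancels the terms in [(s - rho) u v] and leaves
     [u (u + v)^2] below [4 (u + v) ((s - rho) X + c)]; finally [u + v >= v]. Strictness comes from
     [J0] if [v > 0] and from [J1] if [v = 0]. *)
  assert (J : u * v < 4 * ((s - rho) * X + c)).
  { destruct (Req_dec (u + v) 0) as [E|E].
    - assert (u = 0) by lra. assert (v = 0) by lra. subst u v. nra.
    - assert (0 < u + v) by lra.
      apply Rmult_lt_reg_r with (u + v); [assumption|].
      assert (u * (u + v) ^ 2 <= u * (4 * ((s - rho) * X + c + (s - rho) * v)))
        by (apply Rmult_le_compat_l; lra).
      destruct Hv as [Hv|Hv].
      + assert (0 < v * ((s - rho) * X + c - (s - rho) * u)) by (apply Rmult_lt_0_compat; lra).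
        nra.
      + rewrite <- Hv in *. nra. }
  assert (H2 := pow2_ge_0 (y - W / 2)). nra.
Qed.

End Barrier.

(** * The slope of the barrier at a first zero *)

Definition nrm2 (z : C) : R := Re z ^ 2 + Im z ^ 2.

Lemma nrm2_Cmod (z : C) : nrm2 z = Cmod z ^ 2.
Proof. symmetry; apply Cmod2_alt. Qed.

Lemma nrm2_mult (z w : C) : nrm2 (z * w) = nrm2 z * nrm2 w.
Proof. rewrite !nrm2_Cmod, Cmod_mult. ring. Qed.

Lemma nrm2_pos (z : C) : z <> RtoC 0 -> 0 < nrm2 z.
Proof.
  intros H. rewrite nrm2_Cmod. apply pow_lt. now apply Cmod_gt_0.
Qed.

(** The real part of [conj z * w]. Along a curve [u] it gives half the derivative of [nrm2 u], and
    it equals [nrm2 u * Re (u' / u)] without any division. *)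
Definition cdot (z w : C) : R := Re z * Re w + Im z * Im w.

Lemma cdot_factor (g w : C) : cdot g (g * w) = nrm2 g * Re w.
Proof. unfold cdot, nrm2. rewrite Re_mult, Im_mult. ring. Qed.

Lemma one_minus_neq_0 (z : C) : unit_disk z -> (1 - z)%C <> RtoC 0.
Proof.
  unfold unit_disk. intros Hz E.
  assert (z = RtoC 1).
  { replace z with (1 - (1 - z))%C by ring. rewrite E. ring. }
  subst z. rewrite Cmod_1 in Hz. lra.
Qed.

Lemma one_plus_scal_neq_0 (k : R) (z : C) :
  0 <= k <= 1 -> unit_disk z -> (1 + RtoC k * z)%C <> RtoC 0.
Proof.
  unfold unit_disk. intros Hk Hz E.
  assert (E' : (RtoC k * z)%C = (- (1))%C).
  { replace (RtoC k * z)%C with ((1 + RtoC k * z) - 1)%C by ring. rewrite E. ring. }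
  apply (f_equal Cmod) in E'.
  rewrite Cmod_mult, Cmod_R, Cmod_m1, Rabs_pos_eq in E' by lra.
  assert (H := Cmod_ge_0 z). nra.
Qed.

(** Cleared of denominators, the claim is [(1 - |z|)(|z| + Re z) >= 0]. *)
Lemma Re_inv_one_minus (z : C) : unit_disk z -> / (1 + Cmod z) <= Re (/ (1 - z))%C.
Proof.
  intros Hz. assert (Hn := nrm2_pos _ (one_minus_neq_0 z Hz)).
  unfold unit_disk in Hz. assert (H0 := Cmod_ge_0 z).
  assert (Hre := re_le_Cmod z). apply Rabs_le_between in Hre.
  assert (Hm := nrm2_Cmod z). set (m := Cmod z) in *.
  replace (Re (/ (1 - z))%C) with ((1 - Re z) / nrm2 (1 - z)).
  2:{ destruct z as [x y]; unfold nrm2; simpl in *. f_equal. }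
  assert (E : nrm2 (1 - z) = 1 - 2 * Re z + m ^ 2).
  { rewrite <- Hm. unfold nrm2. destruct z; simpl. ring. }
  rewrite E in *.
  apply Rmult_le_reg_r with (1 + m); [lra|]. rewrite Rinv_l by lra.
  apply Rmult_le_reg_r with (1 - 2 * Re z + m ^ 2); [exact Hn|].
  replace ((1 - Re z) / (1 - 2 * Re z + m ^ 2) * (1 + m) * (1 - 2 * Re z + m ^ 2))
    with ((1 - Re z) * (1 + m)) by (field; lra).
  nra.
Qed.

(* [F1] is [z F'(z)], while [G1] and [G2] are the first two derivatives of [G] along the ray through
   [z]; the first hypotheses are the identity [z G' + s G = s (1 + k z) F] and its derivative. *)
Lemma barrier_slope (s k r : R) (z F F1 G G1 G2 : C) :
  0 <= k -> 4 * k <= s -> s * (1 + 5 * k) <= 3 -> 0 < r < 1 ->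
  Cmod z = r -> G <> RtoC 0 ->
  (RtoC r * G1 + RtoC s * G = RtoC s * (1 + RtoC k * z) * F)%C ->
  (RtoC r * G1 + RtoC r * RtoC r * G2 + RtoC s * (RtoC r * G1)
    = RtoC s * (RtoC k * z * F + (1 + RtoC k * z) * F1))%C ->
  ((1 - z) * (F + F1) = G)%C ->
  (1 + r) * cdot G G1 + nrm2 G = 0 ->
  0 < 3 * cdot G G1 + (1 + r) * (nrm2 G1 + cdot G G2).
Proof.
  intros Hk Hks Hs Hr Hz HG E1 E2 E3 H0.
  assert (Hk3 : k <= 3 / 10) by (eapply barrier_k_le; eassumption).
  assert (HzD : unit_disk z) by (unfold unit_disk; lra).
  assert (Hp := one_plus_scal_neq_0 k z ltac:(lra) HzD).
  assert (Hm := one_minus_neq_0 z HzD).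
  assert (Hn := nrm2_pos G HG).
  assert (Hr0 : RtoC r <> RtoC 0) by (intros E; injection E; lra).
  set (P := (RtoC r * G1 / G)%C). set (T := (RtoC r * RtoC r * G2 / G + P)%C).
  set (E := (RtoC k * z / (1 + RtoC k * z))%C).
  set (M := (z / (1 - z))%C).
  assert (EG1 : G1 = (G * (RtoC (/ r) * P))%C).
  { unfold P. rewrite RtoC_inv by lra. field. auto. }
  assert (EG2 : G2 = (G * (RtoC (/ r ^ 2) * (T - P)))%C).
  { unfold T, P. rewrite RtoC_inv, RtoC_pow by nra. field. auto. }
  (* The Riccati equation. With [theta = z d/dz], [T] is [theta (theta G) / G = theta P + P^2]. The
     functions [F] and [F1] have been eliminated by [E1] and [E3], using [1 / (1 + k z) = 1 - E] and
     [(1 + k z) / (1 - z) = 1 + (1 + k) M]. *)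
  assert (ET : T = (- RtoC s * P - (P + RtoC s) * (1 - E)
                    + RtoC s * (1 + (1 + RtoC k) * M))%C).
  { assert (EF1 : F1 = (G / (1 - z) - F)%C).
    { rewrite <- E3. field. exact Hm. }
    assert (ES : (RtoC s * F)%C = ((RtoC r * G1 + RtoC s * G) / (1 + RtoC k * z))%C).
    { rewrite E1. field. exact Hp. }
    assert (ET2 : (RtoC r * G1 + RtoC r * RtoC r * G2)%C
      = (- RtoC s * (RtoC r * G1) - (RtoC s * F) + RtoC s * (1 + RtoC k * z) * (G / (1 - z)))%C).
    { replace (RtoC r * G1 + RtoC r * RtoC r * G2)%C
       with ((RtoC r * G1 + RtoC r * RtoC r * G2 + RtoC s * (RtoC r * G1))
              - RtoC s * (RtoC r * G1))%C by ring.
      rewrite E2, EF1. field. exact Hm. }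
    rewrite ES in ET2.
    transitivity ((RtoC r * G1 + RtoC r * RtoC r * G2) / G)%C.
    - unfold T, P. field. exact HG.
    - rewrite ET2. unfold P, E, M. field. auto. }
  rewrite EG1 in H0. rewrite cdot_factor, Re_RtoC_mult in H0.
  rewrite EG1, EG2, !cdot_factor, !nrm2_mult, !Re_RtoC_mult, Re_minus.
  replace (nrm2 (RtoC (/ r))) with (/ r * / r) by (unfold nrm2; simpl; ring).
  set (rho := r / (1 + r)).
  assert (HP : Re P = - rho).
  { apply Rmult_eq_reg_l with (nrm2 G * ((1 + r) * / r)).
    2:{ apply Rgt_not_eq. apply Rmult_lt_0_compat; [exact Hn|].
        apply Rmult_lt_0_compat; [lra|]. apply Rinv_0_lt_compat; lra. }
    replace (nrm2 G * ((1 + r) * / r) * - rho) with (- nrm2 G) by (unfold rho; field; lra).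
    lra. }
  assert (HM : - rho <= Re M).
  { replace M with (/ (1 - z) - 1)%C by (unfold M; field; exact Hm).
    rewrite Re_minus. assert (HI := Re_inv_one_minus z HzD). rewrite Hz in HI.
    replace (- rho) with (/ (1 + r) - 1) by (unfold rho; field; lra). simpl in *. lra. }
  set (X := Re E). set (W := Im E). set (y := Im P).
  assert (HXW : X ^ 2 + W ^ 2 = (k * r) ^ 2 * ((1 - X) ^ 2 + W ^ 2)).
  { change (X ^ 2 + W ^ 2) with (nrm2 E).
    replace ((1 - X) ^ 2 + W ^ 2) with (nrm2 (1 - E)) by (unfold nrm2, X, W; simpl; ring).
    replace E with ((RtoC k * z) * (1 - E))%C at 1 by (unfold E; field; exact Hp).
    rewrite nrm2_mult, nrm2_mult, (nrm2_Cmod z), Hz. unfold nrm2 at 1. simpl. ring. }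
  assert (HB := barrier_ineq s k r Hk Hks Hs Hr X W y HXW). fold rho in HB.
  assert (HT : Re T = s * rho - (- rho + s) * (1 - X) - y * W + s * (1 + (1 + k) * Re M)).
  { rewrite ET. unfold X, W, y.
    replace (Re (- RtoC s * P - (P + RtoC s) * (1 - E) + RtoC s * (1 + (1 + RtoC k) * M))%C)
      with (- s * Re P - ((Re P + s) * (1 - Re E) + Im P * Im E) + s * (1 + (1 + k) * Re M))
      by (simpl; ring).
    rewrite HP. ring. }
  assert (HsM : - (s * (1 + k) * rho) <= s * (1 + k) * Re M).
  { rewrite Ropp_mult_distr_r. apply Rmult_le_compat_l; [nra|exact HM]. }
  assert (HnP : nrm2 P = rho ^ 2 + y ^ 2) by (unfold nrm2, y; rewrite HP; ring).
  rewrite HnP, HP.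
  replace (3 * (nrm2 G * (/ r * - rho)) +
    (1 + r) * (nrm2 G * (/ r * / r * (rho ^ 2 + y ^ 2)) + nrm2 G * (/ r ^ 2 * (Re T - - rho))))
   with (nrm2 G * ((1 + r) / r ^ 2) * (rho ^ 2 + y ^ 2 + Re T + rho - 3 * rho ^ 2))
   by (unfold rho; field; lra).
  apply Rmult_lt_0_compat.
  - apply Rmult_lt_0_compat; [exact Hn|]. apply Rdiv_lt_0_compat; [lra|apply pow_lt; lra].
  (* Replacing [Re M] by its lower bound [- rho] turns the last factor into exactly the expression
     of [barrier_ineq]. *)
  - rewrite HT. lra.
Qed.

(** * The barrier along a ray *)

(** [k] is specified by an equation rather than a quotient so that [s = 0], that is [a = b = 1], is
    covered by [k = 0]. *)
Lemma admissible_ratio (a b : R) : admissible a b ->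
  exists k, 0 <= k /\ 4 * k <= a + b - 2 /\ (a + b - 2) * (1 + 5 * k) <= 3
    /\ k * (a + b - 2) = (a - 1) * (b - 1).
Proof.
  intros (Ha & Hb & H5). set (s := a + b - 2).
  destruct (Req_dec s 0) as [E|E].
  - exists 0. assert (a = 1) by (unfold s in E; lra). assert (b = 1) by (unfold s in E; lra).
    subst. rewrite E. repeat split; lra.
  - assert (0 < s) by (unfold s in *; lra).
    exists ((a - 1) * (b - 1) / s).
    assert (Hq : 0 <= (a - 1) * (b - 1)) by (apply Rmult_le_pos; lra).
    assert (Hsq := pow2_ge_0 (a - b)).
    repeat split.
    + now apply Rdiv_le_0_compat.
    + apply Rmult_le_reg_r with s; [assumption|].
      replace (4 * ((a - 1) * (b - 1) / s) * s) with (4 * ((a - 1) * (b - 1))) by (field; lra).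
      unfold s. lra.
    + replace (s * (1 + 5 * ((a - 1) * (b - 1) / s))) with (s + 5 * ((a - 1) * (b - 1)))
        by (field; lra). unfold s. lra.
    + field. lra.
Qed.

(** A function that starts positive cannot reach 0 for the first time with positive slope. The slope
    condition may assume positivity on all of [[0, r)], because this is what rules out zeros of [G]
    there. *)
Lemma positive_up_to_first_zero (phi dphi : R -> R) :
  (forall x, 0 <= x < 1 -> is_derive phi x (dphi x)) ->
  0 < phi 0 ->
  (forall r, 0 < r < 1 -> (forall t, 0 <= t < r -> 0 < phi t) -> phi r = 0 -> 0 < dphi r) ->
  forall x, 0 <= x < 1 -> 0 < phi x.
Proof.
  intros Hd H0 Hslope x1 Hx1.
  destruct (Rlt_or_le 0 (phi x1)) as [|Hneg]; [assumption|exfalso].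
  set (E := fun p => 0 <= p <= x1 /\ forall t, 0 <= t <= p -> 0 < phi t).
  assert (E0 : E 0).
  { split; [lra|]. intros t Ht. now replace t with 0 by lra. }
  destruct (completeness E) as [r0 [Hub Hlub]].
  { exists x1. intros p [Hp _]. lra. }
  { now exists 0. }
  assert (Hr0 : 0 <= r0 <= x1).
  { split; [now apply Hub|]. apply Hlub. intros p [Hp _]. lra. }
  assert (Hbelow : forall t, 0 <= t < r0 -> 0 < phi t).
  { intros t Ht. destruct (Rlt_or_le 0 (phi t)) as [|Hn]; [assumption|exfalso].
    assert (r0 <= t); [|lra]. apply Hlub. intros p [Hp Hpp].
    destruct (Rle_or_lt p t) as [|Hlt]; [assumption|].
    assert (0 < phi t) by (apply Hpp; lra). lra. }
  assert (Hc : continuous phi r0).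
  { apply (ex_derive_continuous (K := R_AbsRing) (V := R_NormedModule)).
    exists (dphi r0). apply Hd. lra. }
  (* [r0] is the supremum of the initial intervals of positivity. A negative value there, or a zero
     with positive slope, would make [phi] negative just to the left; a positive value would let the
     interval grow. *)
  destruct (Rtotal_order (phi r0) 0) as [Hlt|[Heq|Hgt]].
  - assert (r0 <> 0) by (intros ->; lra).
    destruct (Hc (fun v => v < 0)) as [d Hd'].
    { apply (open_lt 0). exact Hlt. }
    set (t := r0 - Rmin (r0 / 2) (d / 2)).
    assert (Hmin : 0 < Rmin (r0 / 2) (d / 2)).
    { apply Rmin_glb_lt; [lra|]. apply (is_pos_div_2 d). }
    assert (M1 := Rmin_l (r0 / 2) (d / 2)). assert (M2 := Rmin_r (r0 / 2) (d / 2)).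
    assert (Ht : 0 <= t < r0) by (unfold t; lra).
    assert (phi t < 0).
    { apply Hd'. change (Rabs (t - r0) < d). unfold t.
      assert (Hp := cond_pos d). rewrite Rabs_left by lra. lra. }
    assert (Hp := Hbelow t Ht). lra.
  - assert (r0 <> 0) by (intros ->; lra).
    assert (Hs : 0 < dphi r0) by (apply Hslope; auto; lra).
    assert (HD := Hd r0 ltac:(lra)). apply is_derive_Reals in HD.
    destruct (HD (dphi r0) Hs) as [d Hd'].
    set (h := - Rmin (r0 / 2) (d / 2)).
    assert (Hmin : 0 < Rmin (r0 / 2) (d / 2)).
    { apply Rmin_glb_lt; [lra|]. apply (is_pos_div_2 d). }
    assert (M1 := Rmin_l (r0 / 2) (d / 2)). assert (M2 := Rmin_r (r0 / 2) (d / 2)).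
    assert (Hp := cond_pos d).
    specialize (Hd' h ltac:(unfold h; lra)).
    rewrite Heq, Rminus_0_r in Hd'.
    assert (Hh : Rabs h < d) by (unfold h; rewrite Rabs_left; lra).
    specialize (Hd' Hh). apply Rabs_lt_between in Hd'.
    assert (Hb := Hbelow (r0 + h) ltac:(unfold h; lra)).
    assert (Hhneg : h < 0) by (unfold h; lra).
    assert (phi (r0 + h) / h < 0).
    { apply Ropp_lt_cancel. rewrite Ropp_0.
      replace (- (phi (r0 + h) / h)) with (phi (r0 + h) / - h) by (field; lra).
      apply Rdiv_lt_0_compat; lra. }
    lra.
  - assert (r0 <> x1) by (intros ->; lra).
    destruct (Hc (fun v => 0 < v)) as [d Hd'].
    { apply (open_gt 0). exact Hgt. }
    set (e := Rmin ((x1 - r0) / 2) (d / 2)).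
    assert (Hmin : 0 < e).
    { apply Rmin_glb_lt; [lra|]. apply (is_pos_div_2 d). }
    assert (M1 := Rmin_l ((x1 - r0) / 2) (d / 2)). assert (M2 := Rmin_r ((x1 - r0) / 2) (d / 2)).
    fold e in M1, M2.
    assert (Hp := cond_pos d).
    assert (E (r0 + e)).
    { split; [lra|]. intros t Ht. destruct (Rlt_or_le t r0); [apply Hbelow; lra|].
      apply Hd'. change (Rabs (t - r0) < d). rewrite Rabs_pos_eq by lra. lra. }
    assert (r0 + e <= r0) by now apply Hub. lra.
Qed.

Lemma holo_mult_const (f : C -> C) (z l c : C) :
  holo f z l -> holo (fun w => (f w * c)%C) z (l * c).
Proof.
  intros H eps Heps. assert (Hc := Cmod_ge_0 c).
  destruct (H (eps / (Cmod c + 1))) as [d [Hd Hw]].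
  { apply Rdiv_lt_0_compat; lra. }
  exists d; split; [exact Hd|]. intros w Hwd. specialize (Hw w Hwd).
  replace (f w * c - f z * c - l * c * (w - z))%C
    with ((f w - f z - l * (w - z)) * c)%C by ring.
  rewrite Cmod_mult.
  apply Rle_trans with (eps / (Cmod c + 1) * Cmod (w - z) * Cmod c).
  - now apply Rmult_le_compat_r.
  - replace (eps / (Cmod c + 1) * Cmod (w - z) * Cmod c)
      with (eps * Cmod (w - z) * (Cmod c / (Cmod c + 1))) by (field; lra).
    rewrite <- (Rmult_1_r (eps * Cmod (w - z))) at 2.
    apply Rmult_le_compat_l.
    + apply Rmult_le_pos; [lra|apply Cmod_ge_0].
    + apply Rmult_le_reg_r with (Cmod c + 1); [lra|]. unfold Rdiv.
      rewrite Rmult_assoc, Rinv_l by lra. lra.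
Qed.

Section Ray.
Variables a b : R.
Hypothesis Hab : admissible a b.

Let g := diff_coef a b.
Let G (z : C) : C := CPS g z.
Let DG (z : C) : C := CPS (PS_derive g) z.
Let D2G (z : C) : C := CPS (PS_derive (PS_derive g)) z.

(** The derivative of [CPS_diff_coef_theta]: each side is differentiated as a power series, and
    functions that agree on the disk have the same derivative there. *)
Lemma CPS_diff_coef_theta2 (k : R) (z : C) :
  k * (a + b - 2) = (a - 1) * (b - 1) -> unit_disk z ->
  (DG z + z * D2G z + RtoC (a + b - 2) * DG z)%C
  = (RtoC (a + b - 2) * (RtoC k * CPS (hyp_coef a b) z
     + (1 + RtoC k * z) * CPS (PS_derive (hyp_coef a b)) z))%C.
Proof.
  intros Hk Hz.
  set (A := hyp_coef a b). set (s := a + b - 2) in *.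
  assert (HA : radius_ge_1 A) by now apply radius_hyp_coef.
  assert (Hg : radius_ge_1 g) by now apply radius_diff_coef.
  set (L := fun w => (w * DG w + RtoC s * G w)%C).
  assert (HL : holo L z (DG z + z * D2G z + RtoC s * DG z)).
  { apply holo_unit_ext
      with (CPS (fun n => PS_incr_1 (PS_derive g) n + s * g n)); [exact Hz| |].
    - intros w Hw. unfold L, DG, G.
      rewrite CPS_plus, CPS_incr_1, CPS_scal; auto using radius_derive, radius_incr_1, radius_scal.
    - replace (DG z + z * D2G z + RtoC s * DG z)%C
        with (CPS (PS_derive (fun n => PS_incr_1 (PS_derive g) n + s * g n)) z).
      { apply CPS_holo; [|exact Hz].
        apply radius_plus; auto using radius_derive, radius_incr_1, radius_scal. }
      unfold DG, D2G. rewrite <- CPS_scal, <- CPS_incr_1, <- !CPS_plus;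
        auto using radius_derive, radius_incr_1, radius_scal, radius_plus.
      apply CPS_ext. intros [|n]; unfold PS_derive, PS_incr_1, zero; [simpl; ring|].
      rewrite !S_INR. ring. }
  set (M := fun w => (RtoC s * (1 + RtoC k * w) * CPS A w)%C).
  assert (HM : holo M z (RtoC s * (RtoC k * CPS A z + (1 + RtoC k * z) * CPS (PS_derive A) z))).
  { apply holo_unit_ext
      with (CPS (fun n => s * A n + (s * k) * PS_incr_1 A n)); [exact Hz| |].
    - intros w Hw. unfold M.
      rewrite CPS_plus, !CPS_scal, CPS_incr_1; auto using radius_derive, radius_incr_1, radius_scal.
      rewrite RtoC_mult. ring.
    - replace (RtoC s * (RtoC k * CPS A z + (1 + RtoC k * z) * CPS (PS_derive A) z))%C
        with (CPS (PS_derive (fun n => s * A n + (s * k) * PS_incr_1 A n)) z).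
      { apply CPS_holo; [|exact Hz].
        apply radius_plus; auto using radius_derive, radius_incr_1, radius_scal. }
      transitivity (CPS (fun n => s * PS_derive A n
         + ((s * k) * A n + (s * k) * PS_incr_1 (PS_derive A) n)) z).
      + apply CPS_ext. intros [|n]; unfold PS_derive, PS_incr_1, zero; [simpl; ring|].
        rewrite !S_INR. ring.
      + rewrite !CPS_plus, !CPS_scal, CPS_incr_1;
          auto using radius_derive, radius_incr_1, radius_scal, radius_plus.
        rewrite RtoC_mult. ring. }
  rewrite <- (holo_C_derive _ _ _ HL), <- (holo_C_derive _ _ _ HM).
  apply holo_C_derive. apply holo_unit_ext with M; auto.
  - intros w Hw. symmetry. apply CPS_diff_coef_theta; auto.
  - now rewrite (holo_C_derive _ _ _ HM).
Qed.

Variable v : C.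
Hypothesis Hv : Cmod v = 1.

Let u (r : R) : C := G (RtoC r * v).
Let u1 (r : R) : C := (DG (RtoC r * v) * v)%C.
Let u2 (r : R) : C := (D2G (RtoC r * v) * v * v)%C.
(** Where [u r] is nonzero this is [|u|^2] times [(1 + r) Re (P / r) + 1] for [r > 0], since
    [P = r u1 / u]. *)
Let phi (r : R) : R := (1 + r) * cdot (u r) (u1 r) + nrm2 (u r).

Lemma ray_in_disk (r : R) : 0 <= r < 1 -> unit_disk (RtoC r * v).
Proof.
  intros Hr. unfold unit_disk. rewrite Cmod_mult, Cmod_R, Hv, Rabs_pos_eq; lra.
Qed.

Lemma ray_derivatives (r : R) : 0 <= r < 1 ->
  is_derive (fun x => Re (u x)) r (Re (u1 r)) /\ is_derive (fun x => Im (u x)) r (Im (u1 r)) /\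
  is_derive (fun x => Re (u1 x)) r (Re (u2 r)) /\ is_derive (fun x => Im (u1 x)) r (Im (u2 r)).
Proof.
  intros Hr. assert (Hz := ray_in_disk r Hr).
  assert (Hg : radius_ge_1 g) by now apply radius_diff_coef.
  assert (H1 := CPS_holo g _ Hg Hz).
  assert (H2 := CPS_holo (PS_derive g) _ (radius_derive _ Hg) Hz).
  apply (holo_mult_const _ _ _ v) in H2.
  split; [|split; [|split]].
  - exact (holo_ray_Re _ _ _ _ H1).
  - exact (holo_ray_Im _ _ _ _ H1).
  - exact (holo_ray_Re _ _ _ _ H2).
  - exact (holo_ray_Im _ _ _ _ H2).
Qed.

Lemma ray_phi_derive (r : R) : 0 <= r < 1 ->
  is_derive phi r (3 * cdot (u r) (u1 r) + (1 + r) * (nrm2 (u1 r) + cdot (u r) (u2 r))).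
Proof.
  intros Hr. destruct (ray_derivatives r Hr) as (D1 & D2 & D3 & D4).
  apply is_derive_ext with (fun r => (1 + r) * (Re (u r) * Re (u1 r) + Im (u r) * Im (u1 r))
     + (Re (u r) ^ 2 + Im (u r) ^ 2)); [reflexivity|].
  set (x := fun x => Re (u x)) in *. set (y := fun x => Im (u x)) in *.
  set (x1 := fun x => Re (u1 x)) in *. set (y1 := fun x => Im (u1 x)) in *.
  change (is_derive (fun r => (1 + r) * (x r * x1 r + y r * y1 r) + (x r ^ 2 + y r ^ 2)) r
    (3 * (x r * x1 r + y r * y1 r)
     + (1 + r) * ((x1 r ^ 2 + y1 r ^ 2) + (x r * Re (u2 r) + y r * Im (u2 r))))).
  change (is_derive x r (x1 r)) in D1. change (is_derive y r (y1 r)) in D2.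
  change (is_derive x1 r (Re (u2 r))) in D3. change (is_derive y1 r (Im (u2 r))) in D4.
  assert (X1 : ex_derive x r) by (eexists; eassumption).
  assert (X2 : ex_derive y r) by (eexists; eassumption).
  assert (X3 : ex_derive x1 r) by (eexists; eassumption).
  assert (X4 : ex_derive y1 r) by (eexists; eassumption).
  auto_derive; [repeat split; auto|].
  assert (E1 : Derive (fun t => x t) r = x1 r) by exact (is_derive_unique _ _ _ D1).
  assert (E2 : Derive (fun t => y t) r = y1 r) by exact (is_derive_unique _ _ _ D2).
  assert (E3 : Derive (fun t => x1 t) r = Re (u2 r)) by exact (is_derive_unique _ _ _ D3).
  assert (E4 : Derive (fun t => y1 t) r = Im (u2 r)) by exact (is_derive_unique _ _ _ D4).
  rewrite E1, E2, E3, E4. ring.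
Qed.

(** [(1 + t)^2 |u t|^2] has derivative [2 (1 + t) phi t] and starts at 1, because [G(0) = 1]. *)
Lemma ray_growth (r : R) : 0 < r < 1 -> (forall t, 0 <= t < r -> 0 < phi t) ->
  1 <= (1 + r) ^ 2 * nrm2 (u r).
Proof.
  intros Hr Hphi.
  set (psi := fun t => (1 + t) ^ 2 * nrm2 (u t)).
  assert (Hd : forall t, 0 <= t < 1 -> is_derive psi t (2 * (1 + t) * phi t)).
  { intros t Ht. destruct (ray_derivatives t Ht) as (D1 & D2 & _ & _).
    apply is_derive_ext with (fun t => (1 + t) ^ 2 * (Re (u t) ^ 2 + Im (u t) ^ 2)); [reflexivity|].
    set (x := fun x => Re (u x)) in *. set (y := fun x => Im (u x)) in *.
    change (is_derive (fun t => (1 + t) ^ 2 * (x t ^ 2 + y t ^ 2)) t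
      (2 * (1 + t) * ((1 + t) * (x t * Re (u1 t) + y t * Im (u1 t)) + (x t ^ 2 + y t ^ 2)))).
    change (is_derive x t (Re (u1 t))) in D1. change (is_derive y t (Im (u1 t))) in D2.
    assert (X1 : ex_derive x t) by (eexists; eassumption).
    assert (X2 : ex_derive y t) by (eexists; eassumption).
    auto_derive; [repeat split; auto|].
    assert (E1 : Derive (fun t => x t) t = Re (u1 t)) by exact (is_derive_unique _ _ _ D1).
    assert (E2 : Derive (fun t => y t) t = Im (u1 t)) by exact (is_derive_unique _ _ _ D2).
    rewrite E1, E2. ring. }
  assert (H0 : psi 0 = 1).
  { unfold psi, u, G. replace (RtoC 0 * v)%C with (RtoC 0) by ring.
    rewrite CPS_0. unfold nrm2, g, diff_coef. simpl. ring. }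
  apply Rle_trans with (psi 0); [lra|]. change (psi 0 <= psi r).
  destruct (MVT_gen psi 0 r (fun t => 2 * (1 + t) * phi t)) as [c [Hc E]].
  - intros x. rewrite Rmin_left, Rmax_right by lra. intros Hx. apply Hd. lra.
  - intros x. rewrite Rmin_left, Rmax_right by lra. intros Hx.
    apply derivable_continuous_pt. exists (2 * (1 + x) * phi x).
    apply is_derive_Reals, Hd. lra.
  - rewrite Rmin_left, Rmax_right in Hc by lra.
    (* The mean value point may be [r] itself, where positivity is not assumed; there [0 <= phi r]
       follows by continuity. *)
    assert (0 <= phi c).
    { destruct (Rlt_or_le c r); [apply Rlt_le, Hphi; lra|].
      assert (c = r) by lra. subst c.
      destruct (Rle_or_lt 0 (phi r)) as [|Hn]; [assumption|exfalso].
      assert (Hcont : continuous phi r).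
      { apply (ex_derive_continuous (K := R_AbsRing) (V := R_NormedModule)).
        eexists; apply ray_phi_derive; lra. }
      destruct (Hcont (fun v => v < 0)) as [d Hd'].
      { apply (open_lt 0). exact Hn. }
      assert (Hmin : 0 < Rmin (r / 2) (d / 2)).
      { apply Rmin_glb_lt; [lra|]. apply (is_pos_div_2 d). }
      assert (M1 := Rmin_l (r / 2) (d / 2)). assert (M2 := Rmin_r (r / 2) (d / 2)).
      assert (Hp := cond_pos d).
      assert (phi (r - Rmin (r / 2) (d / 2)) < 0).
      { apply Hd'. change (Rabs (r - Rmin (r / 2) (d / 2) - r) < d).
        rewrite Rabs_left; lra. }
      assert (0 < phi (r - Rmin (r / 2) (d / 2))) by (apply Hphi; lra). lra. }
    assert (0 <= 2 * (1 + c) * phi c) by (apply Rmult_le_pos; lra). nra.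
Qed.

Lemma ray_nonzero (r : R) : 1 <= (1 + r) ^ 2 * nrm2 (u r) -> u r <> RtoC 0.
Proof.
  intros H E. rewrite E in H. unfold nrm2 in H. simpl in H. lra.
Qed.

Lemma ray_phi_pos (r : R) : 0 <= r < 1 -> 0 < phi r.
Proof.
  revert r.
  apply (positive_up_to_first_zero phi
    (fun r => 3 * cdot (u r) (u1 r) + (1 + r) * (nrm2 (u1 r) + cdot (u r) (u2 r)))).
  - exact ray_phi_derive.
  - unfold phi, u, u1, G, DG. replace (RtoC 0 * v)%C with (RtoC 0) by ring.
    rewrite !CPS_0. unfold cdot, nrm2.
    assert (Hre := re_le_Cmod v). rewrite Hv in Hre. apply Rabs_le_between in Hre.
    assert (Hg0 : g 0%nat = 1) by reflexivity.
    (* At the origin [phi] equals [1 + g_1 Re v] with [Re v >= -1], so [g_1 < 1] is the point; here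
       [g_1 (a + b) = a b - 1 + (a - 1)(b - 1)]. *)
    assert (Hg1 : 0 <= PS_derive g 0 < 1).
    { unfold PS_derive. simpl INR. rewrite Rmult_1_l.
      split; [now apply diff_coef_ge_0|].
      assert (E := diff_coef_S a b Hab 0). rewrite hyp_coef_0 in E. simpl INR in E.
      assert (Hq := excess_le a b Hab). destruct Hab as (Ha & Hb & H5).
      change (g 1%nat) with (diff_coef a b 1).
      apply Rmult_lt_reg_r with (a + b); [lra|]. lra. }
    rewrite Hg0. set (g1 := PS_derive g 0) in *.
    rewrite Re_RtoC_mult, Im_RtoC_mult. simpl. nra.
  - intros r Hr Hpos Hz.
    assert (HD := ray_in_disk r ltac:(lra)).
    destruct (admissible_ratio a b Hab) as (k & Hk0 & Hk4 & Hk5 & Hk).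
    assert (Hne := ray_nonzero r (ray_growth r Hr Hpos)).
    set (z := (RtoC r * v)%C) in *.
    apply (barrier_slope (a + b - 2) k r z (CPS (hyp_coef a b) z)
      (z * CPS (PS_derive (hyp_coef a b)) z) (u r) (u1 r) (u2 r)); auto.
    + unfold z. rewrite Cmod_mult, Cmod_R, Hv, Rabs_pos_eq; lra.
    + rewrite <- (CPS_diff_coef_theta a b Hab k z Hk HD). unfold u, u1, G, DG. fold z g.
      generalize (CPS (PS_derive g) z) (CPS g z). intros d d0.
      unfold z; ring.
    + assert (E := CPS_diff_coef_theta2 k z Hk HD).
      transitivity (z * (DG z + z * D2G z + RtoC (a + b - 2) * DG z))%C.
      * unfold u1, u2. fold z. generalize (DG z) (D2G z). intros d d2. unfold z. ring.
      * rewrite E. ring.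
    + rewrite <- CPS_der_coef by assumption. unfold u, G. fold z.
      symmetry. now apply CPS_diff_coef.
Qed.

Lemma ray_G_nonzero (r : R) : 0 <= r < 1 -> u r <> RtoC 0.
Proof.
  intros Hr. destruct (Req_dec r 0) as [->|Hn].
  - unfold u, G. replace (RtoC 0 * v)%C with (RtoC 0) by ring.
    rewrite CPS_0. intros E. injection E. unfold g, diff_coef. lra.
  - apply ray_nonzero, ray_growth; [lra|]. intros t Ht. apply ray_phi_pos. lra.
Qed.

End Ray.

(** * Convexity *)

Lemma polar_direction (z : C) : exists v : C, Cmod v = 1 /\ z = (RtoC (Cmod z) * v)%C.
Proof.
  destruct (Req_dec (Cmod z) 0) as [E|E].
  - exists (RtoC 1). rewrite Cmod_1. split; [reflexivity|].
    rewrite (Cmod_eq_0 z E), Cmod_0. ring.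
  - assert (Hz : RtoC (Cmod z) <> RtoC 0) by (intros H; injection H; auto).
    exists (z / RtoC (Cmod z))%C. split.
    + rewrite Cmod_div, Cmod_R, Rabs_pos_eq by (auto; apply Cmod_ge_0). now field.
    + field. exact Hz.
Qed.

Lemma Rbar_glb_shift (E : R -> Prop) :
  (forall x, E x -> -1 <= x) -> Rbar_le 0 (Rbar_plus 1 (Glb_Rbar E)).
Proof.
  intros H. destruct (Glb_Rbar_correct E) as [_ Hg].
  specialize (Hg (-1) H). destruct (Glb_Rbar E) as [x| |]; simpl in *; try easy. lra.
Qed.

Section Convexity.
Variables a b : R.
Hypothesis Hab : admissible a b.

Let f (z : C) : C := (z * hyp2F1 a b (a + b) z)%C.

Lemma shifted_holo (z : C) : unit_disk z -> holo f z (CPS (der_coef a b) z).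
Proof.
  intros Hz. assert (HA := radius_hyp_coef a b Hab).
  apply holo_unit_ext with (CPS (PS_incr_1 (hyp_coef a b))); [exact Hz| |].
  - intros w Hw. now apply CPS_incr_1.
  - apply CPS_holo; [now apply radius_incr_1|exact Hz].
Qed.

Lemma shifted_C_derive (z : C) : unit_disk z -> C_derive f z = CPS (der_coef a b) z.
Proof. intros Hz. now apply holo_C_derive, shifted_holo. Qed.

Lemma shifted_C_derive2 (z : C) : unit_disk z ->
  C_derive (C_derive f) z = CPS (PS_derive (der_coef a b)) z.
Proof.
  intros Hz. apply holo_C_derive.
  apply holo_unit_ext with (CPS (der_coef a b)); [exact Hz| |].
  - intros w Hw. symmetry. now apply shifted_C_derive.
  - apply CPS_holo; [now apply radius_der_coef|exact Hz].
Qed.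

Lemma CPS_diff_coef_derive (z : C) : unit_disk z ->
  CPS (PS_derive (diff_coef a b)) z
  = ((1 - z) * CPS (PS_derive (der_coef a b)) z - CPS (der_coef a b) z)%C.
Proof.
  intros Hz. assert (Hc := radius_der_coef a b Hab). set (c := der_coef a b) in *.
  transitivity (CPS (fun n => PS_derive c n + -1 * (c n + PS_incr_1 (PS_derive c) n)) z).
  - apply CPS_ext. intros [|n]; unfold PS_derive, PS_incr_1, zero; simpl diff_coef; fold c.
    + simpl. ring.
    + rewrite !S_INR. ring.
  - rewrite CPS_plus, CPS_scal, CPS_plus, CPS_incr_1;
      auto using radius_derive, radius_incr_1, radius_scal, radius_plus.
    replace (RtoC (-1)) with (- (1))%C by (apply C_ext; simpl; ring). ring.
Qed.

Lemma diff_series_nonzero (z : C) : unit_disk z -> CPS (diff_coef a b) z <> RtoC 0.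
Proof.
  intros Hz. destruct (polar_direction z) as (v & Hv & E). rewrite E.
  apply ray_G_nonzero; auto. split; [apply Cmod_ge_0|exact Hz].
Qed.

Lemma der_series_nonzero (z : C) : unit_disk z -> CPS (der_coef a b) z <> RtoC 0.
Proof.
  intros Hz E. apply (diff_series_nonzero z Hz).
  rewrite CPS_diff_coef by assumption. rewrite E. ring.
Qed.

Lemma shifted_curvature (z : C) : unit_disk z ->
  -1 <= Re (z * CPS (PS_derive (der_coef a b)) z / CPS (der_coef a b) z)%C.
Proof.
  intros Hz.
  assert (Hm := one_minus_neq_0 z Hz).
  assert (HG := diff_series_nonzero z Hz).
  assert (Hf := der_series_nonzero z Hz).
  assert (Hphi : exists v, Cmod v = 1 /\ z = (RtoC (Cmod z) * v)%C /\
     0 < (1 + Cmod z) * cdot (CPS (diff_coef a b) z) (CPS (PS_derive (diff_coef a b)) z * v)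
         + nrm2 (CPS (diff_coef a b) z)).
  { destruct (polar_direction z) as (v & Hv & E). exists v. repeat split; auto.
    assert (H := ray_phi_pos a b Hab v Hv (Cmod z) (conj (Cmod_ge_0 z) Hz)).
    cbv beta zeta in H. rewrite <- E in H. exact H. }
  destruct Hphi as (v & Hv & Ez & Hphi).
  assert (HD := CPS_diff_coef_derive z Hz). assert (HGf := CPS_diff_coef a b Hab z Hz).
  set (G := CPS (diff_coef a b) z) in *. set (DG := CPS (PS_derive (diff_coef a b)) z) in *.
  set (f1 := CPS (der_coef a b) z) in *. set (f2 := CPS (PS_derive (der_coef a b)) z) in *.
  assert (Hn := nrm2_pos G HG).
  (* Logarithmic differentiation of [f' = G / (1 - z)], with [z = |z| v]. *)
  replace (z * f2 / f1)%C with (/ (1 - z) - 1 + RtoC (Cmod z) * (DG * v / G))%C.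
  2:{ replace (RtoC (Cmod z) * (DG * v / G))%C with (z * DG / G)%C.
      - rewrite HD, HGf. field. auto.
      - rewrite Ez at 1. field. exact HG. }
  rewrite Re_plus, Re_minus, Re_RtoC_mult.
  assert (H1 := Re_inv_one_minus z Hz). assert (Hr := Cmod_ge_0 z).
  unfold unit_disk in Hz. set (r := Cmod z) in *.
  replace (cdot G (DG * v)) with (nrm2 G * Re (DG * v / G)%C) in Hphi.
  2:{ rewrite <- cdot_factor. f_equal. field. exact HG. }
  set (q := Re (DG * v / G)%C) in *.
  assert (Hq : 0 < (1 + r) * q + 1).
  { apply Rmult_lt_reg_l with (nrm2 G); [exact Hn|]. lra. }
  assert (- (r * / (1 + r)) <= r * q).
  { rewrite Ropp_mult_distr_r. apply Rmult_le_compat_l; [exact Hr|].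
    apply Rmult_le_reg_l with (1 + r); [lra|].
    rewrite <- Ropp_mult_distr_r, Rinv_r by lra. lra. }
  assert (E : / (1 + r) - r * / (1 + r) = (1 - r) * / (1 + r)) by ring.
  assert (0 <= (1 - r) * / (1 + r)).
  { apply Rmult_le_pos; [lra|]. apply Rlt_le, Rinv_0_lt_compat; lra. }
  simpl (Re 1). lra.
Qed.

Lemma shifted_convex : convex_on_disk f.
Proof.
  assert (D0 : unit_disk (RtoC 0)) by (unfold unit_disk; rewrite Cmod_0; lra).
  split; [|split; [|split; [|split]]].
  - intros z Hz. eapply holo_ex_derive, shifted_holo, Hz.
  - unfold f. ring.
  - rewrite shifted_C_derive, CPS_0 by exact D0.
    unfold der_coef. rewrite hyp_coef_0. simpl. now rewrite Rmult_1_l.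
  - intros z Hz. rewrite shifted_C_derive by exact Hz. now apply der_series_nonzero.
  - apply Rbar_glb_shift. intros x (z & Hz & ->).
    rewrite shifted_C_derive, shifted_C_derive2 by exact Hz. now apply shifted_curvature.
Qed.

End Convexity.

(** * The limit formula for the Gamma function *)

Lemma positive_segments (u0 v0 : R) (P : R * R -> Prop) : 0 < u0 ->
  (forall u v, 0 < u < u0 -> v0 < v -> P (u, v)) -> filter_prod (at_right 0) (Rbar_locally p_infty) P.
Proof.
  intros Hu H. apply (Filter_prod _ _ _ (fun u => 0 < u < u0) (fun v => v0 < v)).
  - exists (mkposreal u0 Hu). intros y Hy Hy0.
    change (Rabs (y - 0) < u0) in Hy. rewrite Rminus_0_r in Hy.
    apply Rabs_lt_between in Hy. lra.
  - exists v0. auto.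
  - exact H.
Qed.

Lemma ex_RInt_positive (h : R -> R) (u v : R) :
  (forall t, 0 < t -> continuous h t) -> 0 < u <= v -> ex_RInt h u v.
Proof.
  intros Hc Huv. apply (ex_RInt_continuous (V := R_CompleteNormedModule)).
  rewrite Rmin_left, Rmax_right by lra. intros t Ht. apply Hc. lra.
Qed.

(** For a nonnegative integrand the integrals grow with the segment, so their supremum is the limit;
    it also bounds every partial integral, which later yields [0 < Gamma x]. *)
Lemma is_RInt_gen_monotone_limit (h : R -> R) (M : R) :
  (forall t, 0 < t -> continuous h t) -> (forall t, 0 < t -> 0 <= h t) ->
  (forall u v, 0 < u <= v -> RInt h u v <= M) ->
  exists l, is_RInt_gen h (at_right 0) (Rbar_locally p_infty) l /\
    forall u v, 0 < u <= v -> RInt h u v <= l.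
Proof.
  intros Hc Hpos HM.
  set (E := fun x => exists u v, 0 < u <= v /\ x = RInt h u v).
  destruct (completeness E) as [l [Hub Hlub]].
  { exists M. intros x (u & v & Huv & ->). now apply HM. }
  { exists (RInt h 1 1), 1, 1. split; [lra|reflexivity]. }
  exists l. split.
  2:{ intros u v Huv. apply Hub. now exists u, v. }
  intros P [eps HP].
  assert (He := cond_pos eps).
  assert (Hex : exists u0 v0, 0 < u0 <= v0 /\ l - eps < RInt h u0 v0).
  { apply Classical_Prop.NNPP. intros Hn. assert (l <= l - eps); [|lra].
    apply Hlub. intros x (u & v & Huv & ->).
    destruct (Rle_or_lt (RInt h u v) (l - eps)) as [|Hlt]; [assumption|].
    exfalso. apply Hn. now exists u, v. }
  destruct Hex as (u0 & v0 & Huv0 & Hl).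
  unfold filtermapi. apply (positive_segments u0 v0); [lra|]. intros u v Hu Hv. simpl.
  exists (RInt h u v). split.
  - apply (RInt_correct (V := R_CompleteNormedModule)), ex_RInt_positive; auto; lra.
  - apply HP. change (Rabs (RInt h u v - l) < eps).
    assert (H1 : RInt h u v <= l) by (apply Hub; exists u, v; split; [lra|reflexivity]).
    assert (X1 : ex_RInt h u u0) by (apply ex_RInt_positive; auto; lra).
    assert (X2 : ex_RInt h u0 v0) by (apply ex_RInt_positive; auto; lra).
    assert (X3 : ex_RInt h v0 v) by (apply ex_RInt_positive; auto; lra).
    assert (X4 : ex_RInt h u0 v) by (apply ex_RInt_positive; auto; lra).
    assert (E1 := RInt_Chasles h u u0 v X1 X4). assert (E2 := RInt_Chasles h u0 v0 v X2 X3).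
    assert (P1 : 0 <= RInt h u u0) by (apply RInt_ge_0; auto; [lra|intros; apply Hpos; lra]).
    assert (P3 : 0 <= RInt h v0 v) by (apply RInt_ge_0; auto; [lra|intros; apply Hpos; lra]).
    change (RInt h u u0 + RInt h u0 v = RInt h u v) in E1.
    change (RInt h u0 v0 + RInt h v0 v = RInt h u0 v) in E2.
    rewrite Rabs_left1; lra.
Qed.

(** * Convergence and functional equation of the Gamma integral *)

Lemma exp_le_compat (x y : R) : x <= y -> exp x <= exp y.
Proof. intros [H| ->]; [now apply Rlt_le, exp_increasing|apply Rle_refl]. Qed.

Definition gamma_density (x t : R) : R := Rpower t (x - 1) * exp (- t).

Lemma gamma_density_pos (x t : R) : 0 < gamma_density x t.
Proof. apply Rmult_lt_0_compat; apply exp_pos. Qed.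

Lemma gamma_density_continuous (x t : R) : 0 < t -> continuous (gamma_density x) t.
Proof.
  intros Ht. apply (ex_derive_continuous (K := R_AbsRing) (V := R_NormedModule)).
  unfold gamma_density, Rpower. auto_derive. exact Ht.
Qed.

(** The right side is the tangent of the concave function [ln] at [1 / e]. The slope [e] is free: a
    small one gives the domination by [exp (t / 2)], another one the weighted AM-GM inequality. *)
Lemma ln_le_linear (e t : R) : 0 < e -> 0 < t -> ln t <= e * t - ln e - 1.
Proof.
  intros He Ht. assert (H := exp_ineq1_le (e * t - ln e - 1 - ln t)).
  replace (ln t) with (ln (e * t) - ln e) by (rewrite ln_mult by assumption; ring).
  assert (Het : 0 < e * t) by now apply Rmult_lt_0_compat.
  assert (H1 := exp_ineq1_le (ln (e * t))). rewrite exp_ln in H1 by assumption.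
  lra.
Qed.

Lemma Rpower_le_exp_half (y : R) : 0 <= y ->
  exists c, 0 < c /\ forall t, 0 < t -> Rpower t y <= c * exp (t / 2).
Proof.
  intros Hy. set (e := / (2 * (y + 1))).
  assert (He : 0 < e) by (apply Rinv_0_lt_compat; lra).
  exists (exp (y * (- ln e))). split; [apply exp_pos|]. intros t Ht.
  unfold Rpower. rewrite <- exp_plus. apply exp_le_compat.
  assert (H := ln_le_linear e t He Ht).
  assert (H1 : y * ln t <= y * (e * t - ln e)) by (apply Rmult_le_compat_l; lra).
  assert (H2 : y * e <= / 2).
  { unfold e. apply Rmult_le_reg_r with (2 * (y + 1)); [lra|].
    rewrite Rmult_assoc, Rinv_l by lra. lra. }
  assert (y * e * t <= / 2 * t) by (apply Rmult_le_compat_r; lra). lra.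
Qed.

(** For [x >= 1] the density has no singularity at 0, so a single exponential dominates it on the
    whole half-line. *)
Lemma gamma_density_bound (x : R) : 1 <= x ->
  exists c, 0 < c /\ forall t, 0 < t -> gamma_density x t <= c * exp (- t / 2).
Proof.
  intros Hx. destruct (Rpower_le_exp_half (x - 1)) as (c & Hc & H); [lra|].
  exists c. split; [exact Hc|]. intros t Ht. unfold gamma_density.
  replace (exp (- t / 2)) with (exp (t / 2) * exp (- t)) by (rewrite <- exp_plus; f_equal; field).
  rewrite <- Rmult_assoc. apply Rmult_le_compat_r; [apply Rlt_le, exp_pos|auto].
Qed.

Lemma Gamma_is_RInt_gen (x : R) : 1 <= x ->
  is_RInt_gen (gamma_density x) (at_right 0) (Rbar_locally p_infty) (Gamma x)
  /\ 0 < Gamma x.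
Proof.
  intros Hx. destruct (gamma_density_bound x Hx) as (c & Hc & Hb).
  destruct (is_RInt_gen_monotone_limit (gamma_density x) (2 * c)) as (l & Hl & Hle).
  - apply gamma_density_continuous.
  - intros t _. apply Rlt_le, gamma_density_pos.
  - intros u v Huv.
    assert (HI : is_RInt (fun t => c * exp (- t / 2)) u v
        (- 2 * c * exp (- v / 2) - - 2 * c * exp (- u / 2))).
    { apply (is_RInt_derive (V := R_CompleteNormedModule) (fun t => - 2 * c * exp (- t / 2))).
      - intros t _. auto_derive; [auto|]. unfold Rdiv. field.
      - intros t _. apply (ex_derive_continuous (K := R_AbsRing) (V := R_NormedModule)).
        auto_derive. auto. }
    apply Rle_trans with (RInt (fun t => c * exp (- t / 2)) u v).
    + apply RInt_le; [lra| |eexists; exact HI|].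
      * apply ex_RInt_positive; [apply gamma_density_continuous|lra].
      * intros t Ht. apply Hb. lra.
    + rewrite (is_RInt_unique _ _ _ _ HI).
      assert (0 < exp (- v / 2)) by apply exp_pos.
      assert (exp (- u / 2) <= 1).
      { rewrite <- exp_0. apply exp_le_compat. lra. }
      nra.
  - assert (E : Gamma x = l) by exact (is_RInt_gen_unique (gamma_density x) l Hl).
    rewrite E. split; [exact Hl|].
    apply Rlt_le_trans with (RInt (gamma_density x) 1 2); [|apply Hle; lra].
    apply RInt_gt_0; [lra| |].
    + intros; apply gamma_density_pos.
    + intros t Ht. apply gamma_density_continuous. lra.
Qed.

Lemma Rpower_exp_at_0 (y : R) : 0 < y ->
  filterlim (fun t => Rpower t y * exp (- t)) (at_right 0) (locally 0).
Proof.
  intros Hy. apply filterlim_locally. intros eps.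
  assert (He := cond_pos eps).
  exists (mkposreal (Rpower eps (/ y)) (exp_pos _)). intros t Ht Ht0.
  change (Rabs (t - 0) < Rpower eps (/ y)) in Ht. rewrite Rminus_0_r, Rabs_pos_eq in Ht by lra.
  change (Rabs (Rpower t y * exp (- t) - 0) < eps). rewrite Rminus_0_r.
  assert (HP := gamma_density_pos (y + 1) t). unfold gamma_density in HP.
  replace (y + 1 - 1) with y in HP by ring.
  rewrite Rabs_pos_eq by lra.
  assert (H1 : Rpower t y < eps).
  { rewrite <- (Rpower_1 eps He). replace 1 with (/ y * y) by (field; lra).
    rewrite <- Rpower_mult. apply Rlt_Rpower_l; lra. }
  assert (H2 : exp (- t) <= 1).
  { rewrite <- exp_0. apply exp_le_compat. lra. }
  assert (H3 : 0 < Rpower t y) by apply exp_pos.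
  assert (H4 := exp_pos (- t)). nra.
Qed.

Lemma exp_half_at_infty (c : R) : 0 < c ->
  filterlim (fun t => c * exp (- t / 2)) (Rbar_locally p_infty) (locally 0).
Proof.
  intros Hc. apply filterlim_locally. intros eps. assert (He := cond_pos eps).
  exists (2 * (- ln (eps / c))). intros t Ht.
  change (Rabs (c * exp (- t / 2) - 0) < eps). rewrite Rminus_0_r.
  assert (HP := exp_pos (- t / 2)).
  rewrite Rabs_pos_eq by (apply Rmult_le_pos; lra).
  replace (pos eps) with (c * exp (ln (eps / c))).
  - apply Rmult_lt_compat_l; [exact Hc|]. apply exp_increasing. lra.
  - rewrite exp_ln by now apply Rdiv_lt_0_compat. field. lra.
Qed.

Lemma Rpower_exp_at_infty (y : R) : 0 <= y ->
  filterlim (fun t => Rpower t y * exp (- t)) (Rbar_locally p_infty) (locally 0).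
Proof.
  intros Hy. destruct (gamma_density_bound (y + 1)) as (c & Hc & Hb); [lra|].
  apply (filterlim_le_le (F := Rbar_locally p_infty) (fun _ => 0) _ (fun t => c * exp (- t / 2)) (Finite 0)).
  - exists 0. intros t Ht. specialize (Hb t Ht). unfold gamma_density in Hb.
    replace (y + 1 - 1) with y in Hb by ring. split; [|exact Hb].
    apply Rlt_le, Rmult_lt_0_compat; apply exp_pos.
  - apply filterlim_const.
  - now apply exp_half_at_infty.
Qed.

(** Integration by parts: the derivative of [- t^x exp (- t)] is the difference of the two
    densities, and its improper integral is 0 because both boundary limits vanish. *)
Lemma Gamma_S (x : R) : 1 <= x -> Gamma (x + 1) = x * Gamma x.
Proof.
  intros Hx.
  destruct (Gamma_is_RInt_gen x Hx) as [H1 _].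
  destruct (Gamma_is_RInt_gen (x + 1) ltac:(lra)) as [H2 _].
  set (h := fun t => - (Rpower t x * exp (- t))).
  assert (Hd : forall t, 0 < t ->
     is_derive h t (gamma_density (x + 1) t - x * gamma_density x t)).
  { intros t Ht. unfold h, gamma_density, Rpower. auto_derive; [exact Ht|].
    replace ((x + 1 - 1) * ln t) with (x * ln t) by ring.
    replace (x * ln t) with ((x - 1) * ln t + ln t) by ring.
    rewrite exp_plus, exp_ln by exact Ht. field. lra. }
  assert (Hdd : forall t, 0 < t -> Derive h t = gamma_density (x + 1) t - x * gamma_density x t).
  { intros t Ht. now apply is_derive_unique, Hd. }
  assert (HI : is_RInt_gen (Derive h) (at_right 0) (Rbar_locally p_infty) (0 - 0)).
  { apply is_RInt_gen_Derive.
    - apply (positive_segments 1 1); [lra|]. intros u v Hu Hv. simpl.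
      rewrite Rmin_left, Rmax_right by lra. intros t Ht.
      eexists; apply Hd; lra.
    - apply (positive_segments 1 1); [lra|]. intros u v Hu Hv. simpl.
      rewrite Rmin_left, Rmax_right by lra. intros t Ht.
      apply (continuous_ext_loc _ (fun t => gamma_density (x + 1) t - x * gamma_density x t)).
      + assert (Ht0 : 0 < t) by lra.
        exists (mkposreal t Ht0). intros y Hy. change (Rabs (y - t) < t) in Hy.
        apply Rabs_lt_between in Hy. symmetry; apply Hdd. lra.
      + apply (continuous_minus (V := R_NormedModule)); [apply gamma_density_continuous; lra|].
        apply (continuous_scal_r (V := R_NormedModule) x (gamma_density x)).
        apply gamma_density_continuous; lra.
    - replace 0 with (- 0) at 2 by ring.
      apply (filterlim_comp _ _ _ (fun t => Rpower t x * exp (- t)) Ropp _ (locally 0)).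
      + apply Rpower_exp_at_0; lra.
      + apply (filterlim_opp (K := R_AbsRing) (V := R_NormedModule) 0).
    - replace 0 with (- 0) at 1 by ring.
      apply (filterlim_comp _ _ _ (fun t => Rpower t x * exp (- t)) Ropp _ (locally 0)).
      + apply Rpower_exp_at_infty; lra.
      + apply (filterlim_opp (K := R_AbsRing) (V := R_NormedModule) 0). }
  assert (HJ : is_RInt_gen (Derive h) (at_right 0) (Rbar_locally p_infty)
      (Gamma (x + 1) - x * Gamma x)).
  { apply is_RInt_gen_ext
      with (fun t => minus (gamma_density (x + 1) t) (scal x (gamma_density x t))).
    - apply (positive_segments 1 1); [lra|]. intros u v Hu Hv. simpl.
      rewrite Rmin_left, Rmax_right by lra. intros t Ht. rewrite Hdd by lra. reflexivity.
    - apply (is_RInt_gen_minus (V := R_NormedModule)); [exact H2|].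
      now apply (is_RInt_gen_scal (V := R_NormedModule)). }
  assert (E1 := is_RInt_gen_unique _ _ HI). assert (E2 := is_RInt_gen_unique _ _ HJ).
  rewrite E1 in E2. lra.
Qed.

Lemma Gamma_1 : Gamma 1 = 1.
Proof.
  destruct (Gamma_is_RInt_gen 1 (Rle_refl 1)) as [H1 _].
  set (h := fun t => - exp (- t)).
  assert (Hd : forall t, is_derive h t (exp (- t))).
  { intros t. unfold h. auto_derive; [auto|]. ring. }
  assert (Hdd : forall t, Derive h t = exp (- t)).
  { intros t. now apply is_derive_unique. }
  assert (HI : is_RInt_gen (Derive h) (at_right 0) (Rbar_locally p_infty) (0 - - 1)).
  { apply is_RInt_gen_Derive.
    - apply (positive_segments 1 1); [lra|]. intros u v Hu Hv. simpl. intros t Ht.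
      eexists; apply Hd; lra.
    - apply (positive_segments 1 1); [lra|]. intros u v Hu Hv. simpl. intros t Ht.
      apply (continuous_ext _ _ t (fun t => eq_sym (Hdd t))).
      apply (ex_derive_continuous (K := R_AbsRing) (V := R_NormedModule)). auto_derive. auto.
    - replace (- 1) with (h 0) by (unfold h; rewrite Ropp_0, exp_0; ring).
      eapply filterlim_filter_le_1; [apply filter_le_within|].
      apply (ex_derive_continuous (K := R_AbsRing) (V := R_NormedModule)).
      eexists; apply Hd.
    - replace 0 with (- 0) at 1 by ring.
      apply (filterlim_comp _ _ _ (fun t => exp (- t)) Ropp _ (locally 0)).
      + apply filterlim_ext_loc with (fun t => Rpower t 0 * exp (- t)).
        * exists 0. intros t Ht. rewrite Rpower_O by exact Ht. ring.
        * apply Rpower_exp_at_infty; lra.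
      + apply (filterlim_opp (K := R_AbsRing) (V := R_NormedModule) 0). }
  assert (HJ : is_RInt_gen (Derive h) (at_right 0) (Rbar_locally p_infty) (Gamma 1)).
  { apply is_RInt_gen_ext with (gamma_density 1); [|exact H1].
    apply (positive_segments 1 1); [lra|]. intros u v Hu Hv. simpl.
    rewrite Rmin_left, Rmax_right by lra. intros t Ht.
    rewrite Hdd. unfold gamma_density. rewrite Rminus_diag, Rpower_O by lra. ring. }
  assert (E1 := is_RInt_gen_unique _ _ HI). assert (E2 := is_RInt_gen_unique _ _ HJ).
  rewrite E1 in E2. lra.
Qed.

(** Weighted AM-GM for [w] and 1: the tangent of [ln] at the mean [m] is applied to both numbers,
    and the weighted sum of the right sides is [ln m]. *)
Lemma Rpower_concave_tangent (w x : R) : 0 < w -> 0 <= x <= 1 ->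
  Rpower w x <= x * w + (1 - x).
Proof.
  intros Hw Hx. set (m := x * w + (1 - x)).
  assert (Hm : 0 < m).
  { unfold m. destruct (Req_dec x 0) as [->|]; [lra|].
    assert (0 < x * w) by (apply Rmult_lt_0_compat; lra). lra. }
  rewrite <- (exp_ln m Hm). unfold Rpower. apply exp_le_compat.
  assert (H1 := ln_le_linear (/ m) w (Rinv_0_lt_compat m Hm) Hw).
  assert (H2 := ln_le_linear (/ m) 1 (Rinv_0_lt_compat m Hm) Rlt_0_1).
  rewrite ln_1 in H2. rewrite ln_Rinv in H1, H2 by exact Hm.
  assert (x * ln w <= x * (/ m * w - - ln m - 1)) by (apply Rmult_le_compat_l; lra).
  assert ((1 - x) * 0 <= (1 - x) * (/ m * 1 - - ln m - 1)) by (apply Rmult_le_compat_l; lra).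
  assert (E : x * (/ m * w - - ln m - 1) + (1 - x) * (/ m * 1 - - ln m - 1)
      = / m * m + ln m - 1) by (unfold m at 6; ring).
  rewrite Rinv_l in E by lra. lra.
Qed.

(** Wendel's inequality. Pointwise, [t^x <= y^x (x t / y + 1 - x)]; integrated against the density
    of [y], the right side gives [y^x Gamma y], as [Gamma (y + 1) = y Gamma y]. [RInt_gen_norm] acts
    as monotonicity of the integral. *)
Lemma Gamma_shift_le (y x : R) : 1 <= y -> 0 <= x <= 1 ->
  Gamma (y + x) <= Rpower y x * Gamma y.
Proof.
  intros Hy Hx.
  destruct (Gamma_is_RInt_gen y Hy) as [H1 _].
  destruct (Gamma_is_RInt_gen (y + 1) ltac:(lra)) as [H2 _].
  destruct (Gamma_is_RInt_gen (y + x) ltac:(lra)) as [H3 HP].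
  assert (H4 : is_RInt_gen (fun t => plus (scal (Rpower y x * (1 - x)) (gamma_density y t))
                (scal (Rpower y x * x / y) (gamma_density (y + 1) t)))
     (at_right 0) (Rbar_locally p_infty)
     (plus (scal (Rpower y x * (1 - x)) (Gamma y)) (scal (Rpower y x * x / y) (Gamma (y + 1))))).
  { apply (is_RInt_gen_plus (V := R_NormedModule));
      now apply (is_RInt_gen_scal (V := R_NormedModule)). }
  assert (H5 := fun A B => RInt_gen_norm (V := R_CompleteNormedModule) _ _ _ _ A B H3 H4).
  rewrite Gamma_S in H5 by exact Hy.
  assert (H6 : norm (Gamma (y + x)) <= Rpower y x * (1 - x) * Gamma y
       + Rpower y x * x / y * (y * Gamma y)).
  { apply H5.
    - apply (positive_segments 1 1); [lra|]. intros u v Hu Hv. simpl. lra.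
    - apply (positive_segments 1 1); [lra|]. intros u v Hu Hv. simpl. intros t Ht.
      assert (Ht0 : 0 < t) by lra.
      change (norm (gamma_density (y + x) t)) with (Rabs (gamma_density (y + x) t)).
      rewrite Rabs_pos_eq by apply Rlt_le, gamma_density_pos.
      change (gamma_density (y + x) t <= Rpower y x * (1 - x) * gamma_density y t
              + Rpower y x * x / y * gamma_density (y + 1) t).
      unfold gamma_density.
      replace (y + x - 1) with (y - 1 + x) by ring.
      replace (y + 1 - 1) with (y - 1 + 1) by ring.
      rewrite !Rpower_plus, (Rpower_1 t) by exact Ht0.
      assert (Hw : 0 < t / y) by (apply Rdiv_lt_0_compat; lra).
      assert (HB := Rpower_concave_tangent (t / y) x Hw Hx).
      replace (Rpower t x) with (Rpower y x * Rpower (t / y) x).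
      2:{ rewrite Rpower_mult_distr by lra. f_equal. field. lra. }
      set (p := Rpower t (y - 1)). set (e := exp (- t)).
      replace (Rpower y x * (1 - x) * (p * e) + Rpower y x * x / y * (p * t * e))
        with (p * (Rpower y x * (x * (t / y) + (1 - x))) * e) by (field; lra).
      apply Rmult_le_compat_r; [apply Rlt_le, exp_pos|].
      apply Rmult_le_compat_l; [apply Rlt_le, exp_pos|].
      apply Rmult_le_compat_l; [apply Rlt_le, exp_pos|exact HB]. }
  change (norm (Gamma (y + x))) with (Rabs (Gamma (y + x))) in H6.
  rewrite Rabs_pos_eq in H6 by lra.
  replace (Rpower y x * Gamma y)
    with (Rpower y x * (1 - x) * Gamma y + Rpower y x * x / y * (y * Gamma y))
    by (field; lra).
  exact H6.
Qed.

(** * Asymptotics of Gamma quotients and the limit of the coefficients *)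

Lemma Gamma_pochhammer (x : R) (n : nat) : 1 <= x ->
  Gamma (x + INR n) = pochhammer x n * Gamma x.
Proof.
  intros Hx. induction n as [|n IH].
  - simpl. rewrite Rplus_0_r. ring.
  - rewrite S_INR, <- Rplus_assoc, Gamma_S, IH.
    + simpl. ring.
    + assert (H := pos_INR n). lra.
Qed.

Lemma Gamma_INR_S (n : nat) : Gamma (INR (S n)) = INR (fact n).
Proof.
  induction n as [|n IH]; [exact Gamma_1|].
  rewrite S_INR, Gamma_S, IH.
  - change (fact (S n)) with (S n * fact n)%nat. rewrite mult_INR. reflexivity.
  - rewrite S_INR. assert (H := pos_INR n). lra.
Qed.

Definition gamma_ratio (x : R) (n : nat) : R :=
  Gamma (x + INR (S n)) / (Rpower (INR (S n)) x * Gamma (INR (S n))).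

Lemma lim_S_ratio (x : R) : is_lim_seq (fun n => (INR (S n) + x) / INR (S n)) 1.
Proof.
  apply is_lim_seq_ext with (fun n => 1 + x * / INR (S n)).
  - intros n. assert (H := pos_INR n). rewrite S_INR. field. lra.
  - replace (Finite 1) with (Finite (1 + x * 0)) by (f_equal; ring).
    apply is_lim_seq_plus'; [apply is_lim_seq_const|].
    apply (is_lim_seq_scal_l (fun n => / INR (S n)) x (Finite 0)).
    apply (is_lim_seq_incr_1 (fun n => / INR n)).
    apply (is_lim_seq_inv INR p_infty); [apply is_lim_seq_INR|discriminate].
Qed.

(** Squeeze with [N = n + 1]: Wendel's inequality from [N] gives the upper bound 1. Applied from
    [N + x] with exponent [1 - x], it gives [N Gamma N <= (N + x)^(1-x) Gamma (N + x)], hence the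
    lower bound [N / (N + x)]. *)
Lemma gamma_ratio_lim_frac (x : R) : 0 <= x <= 1 -> is_lim_seq (gamma_ratio x) 1.
Proof.
  intros Hx.
  apply is_lim_seq_le_le with (fun n => / ((INR (S n) + x) / INR (S n))) (fun _ => 1).
  - intros n. unfold gamma_ratio.
    assert (HN : 1 <= INR (S n)) by (rewrite S_INR; assert (H := pos_INR n); lra).
    set (N := INR (S n)) in *.
    destruct (Gamma_is_RInt_gen N HN) as [_ HG].
    assert (HP : 0 < Rpower N x) by apply exp_pos.
    assert (HD : 0 < Rpower N x * Gamma N) by now apply Rmult_lt_0_compat.
    rewrite (Rplus_comm x N).
    split.
    + assert (H := Gamma_shift_le (N + x) (1 - x) ltac:(lra) ltac:(lra)).
      replace (N + x + (1 - x)) with (N + 1) in H by ring.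
      rewrite Gamma_S in H by exact HN.
      destruct (Gamma_is_RInt_gen (N + x) ltac:(lra)) as [_ HGx].
      apply Rmult_le_reg_r with (1 := HD).
      unfold Rdiv at 2. rewrite Rmult_assoc, Rinv_l, Rmult_1_r by lra.
      apply Rmult_le_reg_l with (N + x); [lra|].
      replace ((N + x) * (/ ((N + x) / N) * (Rpower N x * Gamma N)))
        with (Rpower N x * (N * Gamma N)) by (field; lra).
      apply Rle_trans with (Rpower N x * (Rpower (N + x) (1 - x) * Gamma (N + x))).
      * apply Rmult_le_compat_l; lra.
      * rewrite <- Rmult_assoc. apply Rmult_le_compat_r; [lra|].
        apply Rle_trans with (Rpower (N + x) x * Rpower (N + x) (1 - x)).
        -- apply Rmult_le_compat_r; [apply Rlt_le, exp_pos|].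
           apply Rle_Rpower_l; lra.
        -- rewrite <- Rpower_plus. replace (x + (1 - x)) with 1 by ring.
           rewrite Rpower_1; lra.
    + apply Rmult_le_reg_r with (1 := HD).
      unfold Rdiv. rewrite Rmult_assoc, Rinv_l by lra.
      assert (H := Gamma_shift_le N x HN Hx). lra.
  - replace (Finite 1) with (Rbar_inv 1) by (simpl; f_equal; apply Rinv_1).
    apply is_lim_seq_inv; [apply lim_S_ratio|]. intros E; injection E; lra.
  - apply is_lim_seq_const.
Qed.

Lemma gamma_ratio_lim_shift (x : R) : 0 <= x ->
  is_lim_seq (gamma_ratio x) 1 -> is_lim_seq (gamma_ratio (x + 1)) 1.
Proof.
  intros Hx H.
  apply is_lim_seq_ext with (fun n => (INR (S n) + x) / INR (S n) * gamma_ratio x n).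
  - intros n. unfold gamma_ratio.
    assert (HN : 1 <= INR (S n)) by (rewrite S_INR; assert (H' := pos_INR n); lra).
    set (N := INR (S n)) in *.
    destruct (Gamma_is_RInt_gen N HN) as [_ HG].
    assert (HP : 0 < Rpower N x) by apply exp_pos.
    replace (x + 1 + N) with (x + N + 1) by ring.
    rewrite Gamma_S, Rpower_plus, Rpower_1 by lra. field. repeat split; lra.
  - replace (Finite 1) with (Finite (1 * 1)) by (f_equal; ring).
    apply is_lim_seq_mult'; [apply lim_S_ratio|exact H].
Qed.

Lemma gamma_ratio_lim (x : R) : 0 <= x -> is_lim_seq (gamma_ratio x) 1.
Proof.
  intros Hx.
  assert (H : forall m x, 0 <= x <= INR m + 1 -> is_lim_seq (gamma_ratio x) 1).
  { induction m as [|m IH]; intros y Hy.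
    - apply gamma_ratio_lim_frac. simpl in Hy. lra.
    - destruct (Rle_or_lt y 1).
      + apply gamma_ratio_lim_frac. lra.
      + replace y with (y - 1 + 1) by ring. apply gamma_ratio_lim_shift; [lra|].
        apply IH. rewrite S_INR in Hy. lra. }
  destruct (nfloor_ex x Hx) as [m Hm]. apply (H m). lra.
Qed.

Lemma Beta_pos (a b : R) : 1 <= a -> 1 <= b -> 0 < Beta a b.
Proof.
  intros Ha Hb. unfold Beta.
  destruct (Gamma_is_RInt_gen a Ha) as [_ Ga]. destruct (Gamma_is_RInt_gen b Hb) as [_ Gb].
  destruct (Gamma_is_RInt_gen (a + b) ltac:(lra)) as [_ Gab].
  apply Rdiv_lt_0_compat; [now apply Rmult_lt_0_compat|exact Gab].
Qed.

Lemma der_coef_lim (a b : R) : 1 <= a -> 1 <= b ->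
  is_lim_seq (der_coef a b) (/ Beta a b).
Proof.
  intros Ha Hb. apply is_lim_seq_incr_1.
  destruct (Gamma_is_RInt_gen a Ha) as [_ Ga]. destruct (Gamma_is_RInt_gen b Hb) as [_ Gb].
  destruct (Gamma_is_RInt_gen (a + b) ltac:(lra)) as [_ Gab].
  (* The powers [N^a N^b / N^(a+b)] cancel. The last factor [(N + 1) / N] combines the factor
     [N + 1] of [der_coef] with [N! = N Gamma N]. *)
  apply is_lim_seq_ext with (fun n => / Beta a b *
    (gamma_ratio a n * gamma_ratio b n / gamma_ratio (a + b) n * ((INR (S n) + 1) / INR (S n)))).
  - intros n. unfold gamma_ratio, der_coef, hyp_coef, Beta.
    rewrite (S_INR (S n)). rewrite !Gamma_pochhammer by lra.
    rewrite Gamma_INR_S. change (fact (S n)) with (S n * fact n)%nat. rewrite mult_INR.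
    assert (HN : 1 <= INR (S n)) by (rewrite S_INR; assert (H' := pos_INR n); lra).
    assert (Hf := INR_fact_lt_0 n).
    assert (P1 : 0 < pochhammer a (S n)) by (apply pochhammer_pos; lra).
    assert (P2 : 0 < pochhammer b (S n)) by (apply pochhammer_pos; lra).
    assert (P3 : 0 < pochhammer (a + b) (S n)) by (apply pochhammer_pos; lra).
    rewrite Rpower_plus.
    assert (Q1 : 0 < Rpower (INR (S n)) a) by apply exp_pos.
    assert (Q2 : 0 < Rpower (INR (S n)) b) by apply exp_pos.
    set (p1 := pochhammer a (S n)) in *. set (p2 := pochhammer b (S n)) in *.
    set (p3 := pochhammer (a + b) (S n)) in *. set (N := INR (S n)) in *.
    field. repeat split; lra.
  - replace (Finite (/ Beta a b)) with (Finite (/ Beta a b * (1 * 1 / 1 * 1)))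
      by (f_equal; field; apply Rgt_not_eq, Beta_pos; assumption).
    apply is_lim_seq_mult'; [apply is_lim_seq_const|].
    apply is_lim_seq_mult'; [|apply lim_S_ratio].
    apply is_lim_seq_div'; [|apply gamma_ratio_lim; lra|lra].
    apply is_lim_seq_mult'; apply gamma_ratio_lim; lra.
Qed.

(** * Trigonometric sums *)

Lemma sin_step (x t : R) : sin ((x + 1) * t) = sin (x * t) * cos t + cos (x * t) * sin t.
Proof. rewrite <- sin_plus. f_equal. ring. Qed.

Lemma cos_step (x t : R) : cos ((x + 1) * t) = cos (x * t) * cos t - sin (x * t) * sin t.
Proof. rewrite <- cos_plus. f_equal. ring. Qed.

Lemma sin_three_term (x t : R) :
  sin ((x + 1 + 1) * t) = 2 * cos t * sin ((x + 1) * t) - sin (x * t).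
Proof.
  rewrite (sin_step (x + 1)), sin_step, cos_step.
  assert (H := sin2_cos2 t). unfold Rsqr in H.
  replace (2 * cos t * (sin (x * t) * cos t + cos (x * t) * sin t) - sin (x * t))
    with (2 * cos t * (sin (x * t) * cos t + cos (x * t) * sin t)
      - sin (x * t) * (sin t * sin t + cos t * cos t)) by (rewrite H; ring).
  ring.
Qed.

Lemma abs_sin_mult_le (n : nat) (t : R) : 0 <= sin t -> Rabs (sin (INR n * t)) <= INR n * sin t.
Proof.
  intros Ht. induction n as [|n IH].
  - simpl. rewrite !Rmult_0_l, sin_0, Rabs_R0. lra.
  - rewrite S_INR, sin_step.
    eapply Rle_trans; [apply Rabs_triang|]. rewrite !Rabs_mult, (Rabs_pos_eq (sin t)) by exact Ht.
    assert (H1 : Rabs (cos t) <= 1) by (apply Rabs_le, COS_bound).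
    assert (H2 : Rabs (cos (INR n * t)) <= 1) by (apply Rabs_le, COS_bound).
    assert (H3 := Rabs_pos (sin (INR n * t))). nra.
Qed.

Definition polar (r t : R) : C := (r * cos t, r * sin t).

Lemma Cpow_polar (r t : R) (n : nat) : (polar r t ^ n)%C = polar (r ^ n) (INR n * t).
Proof.
  unfold polar.
  induction n as [|n IH].
  - simpl. rewrite Rmult_0_l, cos_0, sin_0, Rmult_1_l, Rmult_0_r. reflexivity.
  - rewrite Cpow_S, IH, S_INR, sin_step, cos_step.
    apply injective_projections; simpl; ring.
Qed.

Lemma Cmod_polar (r t : R) : 0 <= r -> Cmod (polar r t) = r.
Proof.
  intros Hr. unfold Cmod, polar. simpl fst; simpl snd.
  replace ((r * cos t) ^ 2 + (r * sin t) ^ 2) with (r ^ 2 * ((sin t)² + (cos t)²))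
    by (unfold Rsqr; ring).
  rewrite sin2_cos2, Rmult_1_r. now apply sqrt_pow2.
Qed.

Lemma polar_upper (z : C) : 0 <= Im z ->
  exists t, 0 <= t <= PI /\ z = polar (Cmod z) t.
Proof.
  intros Hi. destruct (Req_dec (Cmod z) 0) as [E|E].
  - exists 0. split; [assert (H := PI_RGT_0); lra|].
    unfold polar. rewrite E, !Rmult_0_l. exact (Cmod_eq_0 z E).
  - assert (Hp : 0 < Cmod z) by (assert (H := Cmod_ge_0 z); lra).
    assert (Hre := re_le_Cmod z). apply Rabs_le_between in Hre.
    set (x := Re z / Cmod z).
    assert (Hx : -1 <= x <= 1).
    { unfold x. split; apply Rmult_le_reg_r with (Cmod z); auto;
        unfold Rdiv; rewrite Rmult_assoc, Rinv_l by lra; lra. }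
    exists (acos x). split; [apply acos_bound|].
    unfold polar. rewrite cos_acos, sin_acos by exact Hx.
    assert (Hm := Cmod2_alt z).
    apply injective_projections; simpl.
    + unfold x, Re. field. exact E.
    + replace (1 - x²) with ((Im z / Cmod z) ^ 2).
      * rewrite sqrt_pow2 by (apply Rdiv_le_0_compat; lra). unfold Im. field. exact E.
      * unfold x, Rsqr.
        replace ((Im z / Cmod z) ^ 2) with ((Cmod z ^ 2 - Re z ^ 2) / Cmod z ^ 2)
          by (replace (Cmod z ^ 2 - Re z ^ 2) with (Im z ^ 2) by lra; field; exact E).
        field. exact E.
Qed.

(** * Positivity of sine series *)

Lemma Series_lim_sum (u : nat -> R) : ex_series u -> is_lim_seq (sum_f_R0 u) (Series u).
Proof.
  intros H. apply is_lim_seq_ext with (sum_n u); [apply sum_n_Reals|].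
  exact (Series_correct u H).
Qed.

Lemma Series_ge_0_of_sums (u : nat -> R) :
  ex_series u -> (forall n, 0 <= sum_f_R0 u n) -> 0 <= Series u.
Proof.
  intros H Hn.
  exact (is_lim_seq_le (fun _ => 0) _ 0 (Series u) Hn (is_lim_seq_const 0) (Series_lim_sum u H)).
Qed.

(** [(2 - 2 cos t) sin (n t)] is minus the second difference of [sin (n t)], so two summations by
    parts move the second differences to [d]. They are nonnegative there, and [sin (n t) <= n sin t]
    makes the sum telescope into the coefficient of [sin t]. *)
Lemma convex_sine_sum (d : nat -> R) (t : R) (N : nat) : 0 <= sin t ->
  (forall n, 2 * d (S n) <= d n + d (S (S n))) ->
  sin t * ((INR N + 2) * d N - (INR N + 1) * d (S N))
    + d (S N) * sin ((INR N + 1) * t) - d N * sin ((INR N + 1 + 1) * t)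
  <= (2 - 2 * cos t) * sum_f_R0 (fun n => d n * sin (INR (S n) * t)) N.
Proof.
  intros Ht Hd. induction N as [|N IH].
  - simpl sum_f_R0. simpl INR. rewrite !Rplus_0_l.
    rewrite (sin_step 1), !Rmult_1_l. right. ring.
  - rewrite tech5, Rmult_plus_distr_l, !S_INR.
    assert (H3 := sin_three_term (INR N + 1) t).
    assert (H := abs_sin_mult_le (S (S N)) t Ht). rewrite !S_INR in H.
    apply Rabs_le_between in H.
    set (s1 := sin ((INR N + 1) * t)) in *. set (s2 := sin ((INR N + 1 + 1) * t)) in *.
    rewrite H3.
    assert (HD := Hd N).
    assert (0 <= (d N + d (S (S N)) - 2 * d (S N)) * ((INR N + 1 + 1) * sin t - s2))
      by (apply Rmult_le_pos; lra).
    nra.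
Qed.

(** In [convex_sine_sum] the coefficient of [sin t] is nonnegative for decreasing [d], and the two
    boundary terms are at least [- d (S N) - d N], which tends to 0. *)
Lemma convex_sine_series (d : nat -> R) (t : R) :
  0 <= sin t -> cos t < 1 -> (forall n, 2 * d (S n) <= d n + d (S (S n))) ->
  (forall n, d (S n) <= d n) -> (forall n, 0 <= d n) -> is_lim_seq d 0 ->
  ex_series (fun n => d n * sin (INR (S n) * t)) ->
  0 <= Series (fun n => d n * sin (INR (S n) * t)).
Proof.
  intros Hs Hc Hconv Hdec Hpos Hlim Hex.
  apply Rmult_le_reg_l with (2 - 2 * cos t); [lra|]. rewrite Rmult_0_r.
  assert (HL := is_lim_seq_scal_l _ (2 - 2 * cos t) _ (Series_lim_sum _ Hex)).
  assert (HR : is_lim_seq (fun n => - d (S n) - d n) 0).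
  { replace (Finite 0) with (Finite (- 0 - 0)) by (f_equal; ring).
    apply is_lim_seq_minus'; [|exact Hlim].
    apply (is_lim_seq_opp (fun n => d (S n)) 0). now apply (is_lim_seq_incr_1 d). }
  refine (is_lim_seq_le _ _ 0 _ _ HR HL). intros N. cbv beta.
  eapply Rle_trans; [|now apply convex_sine_sum].
  assert (B1 := SIN_bound ((INR N + 1) * t)). assert (B2 := SIN_bound ((INR N + 1 + 1) * t)).
  assert (P0 := Hpos N). assert (P1 := Hpos (S N)). assert (P2 := Hdec N).
  assert (HN := pos_INR N).
  assert (0 <= sin t * ((INR N + 2) * d N - (INR N + 1) * d (S N))).
  { apply Rmult_le_pos; [exact Hs|]. nra. }
  assert (- d (S N) <= d (S N) * sin ((INR N + 1) * t)) by nra.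
  assert (d N * sin ((INR N + 1 + 1) * t) <= d N) by nra.
  lra.
Qed.

(** Summation by parts, hidden in a stronger induction claim: the weighted sum is at least the last
    weight times the plain sum. *)
Lemma abel_nonneg (w x : nat -> R) :
  (forall n, 0 <= w n) -> (forall n, w (S n) <= w n) -> (forall n, 0 <= sum_f_R0 x n) ->
  forall n, 0 <= sum_f_R0 (fun k => w k * x k) n.
Proof.
  intros Hw Hd Hx.
  assert (H : forall n, w n * sum_f_R0 x n <= sum_f_R0 (fun k => w k * x k) n).
  { induction n as [|n IH]; [simpl; lra|]. rewrite !tech5, Rmult_plus_distr_l.
    assert (w (S n) * sum_f_R0 x n <= w n * sum_f_R0 x n) by now apply Rmult_le_compat_r.
    lra. }
  intros n. eapply Rle_trans; [|apply H]. now apply Rmult_le_pos.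
Qed.

Definition sine_sum (n : nat) (t : R) : R :=
  sum_f_R0 (fun k => sin (INR (S k) * t) / INR (S k)) n.

Lemma sine_sum_derive (n : nat) (t : R) :
  derivable_pt_lim (sine_sum n) t (sum_f_R0 (fun k => cos (INR (S k) * t)) n).
Proof.
  assert (Hk : forall k, is_derive (fun t => sin (INR (S k) * t) / INR (S k)) t (cos (INR (S k) * t))).
  { intros k. assert (H : INR (S k) <> 0) by (apply not_0_INR; discriminate).
    set (x := INR (S k)) in *. auto_derive; [auto|]. field. exact H. }
  apply is_derive_Reals. unfold sine_sum. induction n as [|n IH].
  - apply Hk.
  - rewrite tech5.
    apply is_derive_ext with (fun t => sum_f_R0 (fun k => sin (INR (S k) * t) / INR (S k)) n
        + sin (INR (S (S n)) * t) / INR (S (S n))).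
    + intros y. now rewrite tech5.
    + apply (is_derive_plus (V := R_NormedModule)); [exact IH|apply Hk].
Qed.

Lemma cosine_sum_closed (n : nat) (t : R) :
  2 * sin (t / 2) * sum_f_R0 (fun k => cos (INR (S k) * t)) n
  = sin (INR (S n) * t + t / 2) - sin (t / 2).
Proof.
  assert (P : forall y, 2 * sin (t / 2) * cos y = sin (y + t / 2) - sin (y - t / 2)).
  { intros y. rewrite sin_plus, sin_minus. ring. }
  induction n as [|n IH].
  - simpl sum_f_R0. rewrite P. f_equal. simpl INR. f_equal. field.
  - rewrite tech5, Rmult_plus_distr_l, IH, P.
    replace (INR (S (S n)) * t - t / 2) with (INR (S n) * t + t / 2)
      by (rewrite (S_INR (S n)); field).
    ring.
Qed.

Lemma sin_INR_PI (n : nat) : sin (INR n * PI) = 0.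
Proof.
  induction n as [|n IH]; [simpl; now rewrite Rmult_0_l, sin_0|].
  rewrite S_INR, sin_step, IH, sin_PI. ring.
Qed.

(* Landau's induction: at an interior minimum the last summand is nonnegative. *)
Lemma fejer_jackson (n : nat) (t : R) : 0 <= t <= PI -> 0 <= sine_sum n t.
Proof.
  revert t. assert (HPI := PI_RGT_0).
  induction n as [|n IH]; intros t Ht.
  - unfold sine_sum. simpl. rewrite Rmult_1_l, Rdiv_1_r. apply sin_ge_0; lra.
  - destruct (continuity_ab_min (sine_sum (S n)) 0 PI) as (t0 & Hmin & Ht0); [lra| |].
    { intros c Hc. apply derivable_continuous_pt. eexists. apply sine_sum_derive. }
    eapply Rle_trans; [|apply Hmin, Ht].
    destruct (Req_dec t0 0) as [->|N0].
    { right. symmetry. apply sum_eq_R0. intros k _. rewrite Rmult_0_r, sin_0. apply Rdiv_0_l. }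
    destruct (Req_dec t0 PI) as [->|NPI].
    { right. symmetry. apply sum_eq_R0. intros k _. rewrite sin_INR_PI. apply Rdiv_0_l. }
    assert (Hd := sine_sum_derive (S n) t0).
    set (pr := exist _ _ Hd : derivable_pt (sine_sum (S n)) t0).
    assert (HD : derive_pt (sine_sum (S n)) t0 pr = 0).
    { apply (deriv_minimum _ 0 PI); [lra|lra|]. intros x Hx0 Hx1. apply Hmin. lra. }
    simpl derive_pt in HD.
    assert (E : sum_f_R0 (fun k => cos (INR (S k) * t0)) (S n) = 0) by exact HD.
    assert (C := cosine_sum_closed (S n) t0). rewrite E, Rmult_0_r in C.
    set (y := INR (S (S n)) * t0) in *.
    assert (Hs : 0 <= sin (t0 / 2)) by (apply sin_ge_0; lra).
    assert (Hc : 0 <= cos (t0 / 2)) by (apply cos_ge_0; lra).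
    assert (Hy : sin y = sin (y + t0 / 2) * cos (t0 / 2) - cos (y + t0 / 2) * sin (t0 / 2)).
    { rewrite <- sin_minus. f_equal. ring. }
    (* The closed form of the vanishing derivative equates the two sines, so the cosines agree up to
       sign and [cos (t0 / 2)] is the larger. Hence [sin y = sin (t0 / 2) (cos (t0 / 2) - cos (y +
       t0 / 2)) >= 0]. *)
    assert (Hss : sin (y + t0 / 2) = sin (t0 / 2)) by lra.
    assert (Q1 := sin2_cos2 (y + t0 / 2)). assert (Q2 := sin2_cos2 (t0 / 2)).
    unfold Rsqr in Q1, Q2.
    assert (Hcc : cos (y + t0 / 2) <= cos (t0 / 2)).
    { rewrite Hss in Q1. apply Rsqr_incr_0_var; [|exact Hc]. unfold Rsqr. lra. }
    assert (Hlast : 0 <= sin y).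
    { rewrite Hy, Hss. nra. }
    unfold sine_sum. rewrite tech5. apply Rplus_le_le_0_compat.
    + apply IH. lra.
    + apply Rdiv_le_0_compat; [exact Hlast|]. apply lt_0_INR. lia.
Qed.

(** * The strip *)

(** The denominator is [|1 - x e^(it)|^2 = 1 - 2 x cos t + x^2]; multiplied by it, the partial sums
    telescope by the three-term recurrence of the sines. *)
Lemma sine_power_series (x t : R) : 0 <= x < 1 ->
  PSeries (fun n => sin (INR (S n) * t)) x = sin t / ((1 - x * cos t) ^ 2 + (x * sin t) ^ 2).
Proof.
  intros Hx. set (u := fun n => sin (INR (S n) * t) * x ^ n).
  assert (Hex : ex_series u).
  { apply ex_series_dominated with (fun n => x ^ n).
    - intros n. unfold u. rewrite Rabs_mult, (Rabs_pos_eq (x ^ n)) by (apply pow_le; lra).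
      rewrite <- (Rmult_1_l (x ^ n)) at 2. apply Rmult_le_compat_r; [apply pow_le; lra|].
      apply Rabs_le, SIN_bound.
    - exists (/ (1 - x)). apply is_series_geom. rewrite Rabs_pos_eq; lra. }
  set (q := (1 - x * cos t) ^ 2 + (x * sin t) ^ 2).
  assert (Hcs := sin2_cos2 t). unfold Rsqr in Hcs.
  assert (Hq : q = 1 - 2 * x * cos t + x ^ 2).
  { unfold q. replace (x ^ 2) with (x ^ 2 * (sin t * sin t + cos t * cos t)) by (rewrite Hcs; ring). ring. }
  assert (Hq0 : 0 < q).
  { rewrite Hq. assert (Hc := COS_bound t). assert (0 < (1 - x) ^ 2) by (apply pow_lt; lra). nra. }
  assert (Hsum : forall N, q * sum_f_R0 u N
     = sin t - x ^ (S N) * sin ((INR N + 1 + 1) * t) + x ^ S (S N) * sin ((INR N + 1) * t)).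
  { rewrite Hq. induction N as [|N IH].
    - unfold u. simpl sum_f_R0. simpl INR. rewrite Rplus_0_l, (sin_step 1), !Rmult_1_l. ring.
    - rewrite tech5, Rmult_plus_distr_l, IH. unfold u at 1. rewrite !S_INR.
      rewrite (sin_three_term (INR N + 1)). simpl pow. ring. }
  assert (Hpow : is_lim_seq (fun N => x ^ N) 0) by (apply is_lim_seq_geom; rewrite Rabs_pos_eq; lra).
  assert (Hbd : forall y : nat -> R, is_lim_seq (fun N => x ^ S N * sin (y N)) 0).
  { intros y. apply is_lim_seq_le_le with (fun N => - x ^ S N) (fun N => x ^ S N).
    - intros N. assert (0 <= x ^ S N) by (apply pow_le; lra).
      assert (B := SIN_bound (y N)). split; nra.
    - replace (Finite 0) with (Finite (- 0)) by (f_equal; ring).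
      apply (is_lim_seq_opp (fun N => x ^ S N) 0). now apply (is_lim_seq_incr_1 (fun N => x ^ N)).
    - now apply (is_lim_seq_incr_1 (fun N => x ^ N)). }
  assert (H1 : is_lim_seq (fun N => q * sum_f_R0 u N) (sin t - 0 + x * 0)).
  { apply is_lim_seq_ext with (fun N => sin t - x ^ (S N) * sin ((INR N + 1 + 1) * t)
        + x * (x ^ S N * sin ((INR N + 1) * t))).
    - intros N. rewrite Hsum. simpl pow. ring.
    - apply is_lim_seq_plus'; [apply is_lim_seq_minus'; [apply is_lim_seq_const|apply Hbd]|].
      apply is_lim_seq_mult'; [apply is_lim_seq_const|apply Hbd]. }
  assert (H2 := is_lim_seq_mult' _ _ _ _ (is_lim_seq_const q) (Series_lim_sum u Hex)).
  assert (E := is_lim_seq_unique _ _ H1). rewrite (is_lim_seq_unique _ _ H2) in E.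
  injection E as E. change (PSeries (fun n => sin (INR (S n) * t)) x) with (Series u).
  apply Rmult_eq_reg_l with q; [|lra]. rewrite E. field. lra.
Qed.

(** Both sides are [Im (- log (1 - z))] at [z = r e^(it)]. No complex logarithm is involved: as
    functions of [r] they have the same derivative and vanish at 0. *)
Lemma atan_sine_series (r t : R) : 0 <= r < 1 ->
  Series (fun n => r ^ S n * (sin (INR (S n) * t) / INR (S n)))
  = atan (r * sin t / (1 - r * cos t)).
Proof.
  intros Hr. set (b := fun n => sin (INR (S n) * t) / INR (S n)).
  assert (Hb : radius_ge_1 b).
  { apply radius_of_bounded with 1. intros n. unfold b, Rdiv.
    rewrite Rabs_mult, Rabs_inv, (Rabs_pos_eq (INR (S n))) by apply pos_INR.
    assert (H1 : Rabs (sin (INR (S n) * t)) <= 1) by (apply Rabs_le, SIN_bound).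
    assert (Hn : 1 <= INR (S n)) by (rewrite S_INR; assert (H := pos_INR n); lra).
    apply Rmult_le_reg_r with (INR (S n)); [lra|].
    rewrite Rmult_assoc, Rinv_l by lra. lra. }
  set (h := fun x => PSeries (PS_incr_1 b) x - atan (x * sin t / (1 - x * cos t))).
  assert (Hden : forall x, 0 <= x < 1 -> 0 < 1 - x * cos t).
  { intros x Hx. assert (Hc := COS_bound t). nra. }
  assert (Hd : forall x, 0 <= x < 1 -> is_derive h x 0).
  { intros x Hx. specialize (Hden x Hx).
    assert (D1 : is_derive (PSeries (PS_incr_1 b)) x (PSeries (PS_derive (PS_incr_1 b)) x)).
    { apply is_derive_PSeries. rewrite Rabs_pos_eq by lra.
      apply Rbar_lt_le_trans with 1; [simpl; lra|]. now apply radius_incr_1. }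
    rewrite (PSeries_ext _ (fun n => sin (INR (S n) * t))) in D1.
    2:{ intros n. unfold PS_derive, PS_incr_1, b. field. apply not_0_INR. discriminate. }
    rewrite sine_power_series in D1 by exact Hx.
    assert (D2 : is_derive (fun x => atan (x * sin t / (1 - x * cos t))) x
       (sin t / ((1 - x * cos t) ^ 2 + (x * sin t) ^ 2))).
    { assert (0 < (1 - x * cos t) ^ 2) by now apply pow_lt.
      assert (0 <= (x * sin t) ^ 2) by apply pow2_ge_0.
      auto_derive; [lra|]. field. repeat split; lra. }
    replace 0 with (sin t / ((1 - x * cos t) ^ 2 + (x * sin t) ^ 2)
        - sin t / ((1 - x * cos t) ^ 2 + (x * sin t) ^ 2)) by ring.
    apply (is_derive_minus (V := R_NormedModule) _ _ _ _ _ D1 D2). }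
  assert (H0 : h 0 = 0).
  { unfold h. rewrite PSeries_incr_1, !Rmult_0_l, Rdiv_0_l, atan_0. ring. }
  assert (E : h r = 0).
  { destruct (MVT_gen h 0 r (fun _ => 0)) as [c [_ E]].
    - intros x. rewrite Rmin_left, Rmax_right by lra. intros Hx. apply Hd. lra.
    - intros x. rewrite Rmin_left, Rmax_right by lra. intros Hx.
      apply derivable_continuous_pt. exists 0. apply is_derive_Reals, Hd. lra.
    - lra. }
  assert (E' : PSeries (PS_incr_1 b) r = atan (r * sin t / (1 - r * cos t)))
    by (unfold h in E; lra).
  rewrite <- E', PSeries_incr_1. unfold PSeries. rewrite <- Series_scal_l.
  apply Series_ext. intros n. unfold b. simpl pow. ring.
Qed.

Section Strip.
Variables a b : R.
Hypothesis Hab : admissible a b.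

Let f (z : C) : C := (z * hyp2F1 a b (a + b) z)%C.
Let L : R := / Beta a b.

Let HL : 0 < L.
Proof. destruct Hab as (Ha & Hb & _). now apply Rinv_0_lt_compat, Beta_pos. Qed.

Lemma polar_in_disk (r t : R) : 0 <= r < 1 -> unit_disk (polar r t).
Proof. intros Hr. unfold unit_disk. rewrite Cmod_polar; lra. Qed.

Lemma shifted_Im_polar (r t : R) : 0 <= r < 1 ->
  ex_series (fun n => hyp_coef a b n * r ^ S n * sin (INR (S n) * t)) /\
  Im (f (polar r t)) = Series (fun n => hyp_coef a b n * r ^ S n * sin (INR (S n) * t)).
Proof.
  intros Hr. assert (Hz := polar_in_disk r t Hr).
  assert (HA := radius_hyp_coef a b Hab).
  assert (E : f (polar r t) = CPS (PS_incr_1 (hyp_coef a b)) (polar r t))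
    by (symmetry; now apply CPS_incr_1).
  assert (T : forall n, PS_incr_1 (hyp_coef a b) (S n) * Im (polar r t ^ S n)%C
     = hyp_coef a b n * r ^ S n * sin (INR (S n) * t)).
  { intros n. rewrite Cpow_polar. unfold PS_incr_1, polar, Im, snd. ring. }
  split.
  - apply ex_series_ext with (1 := T).
    apply (ex_series_incr_1 (fun n => PS_incr_1 (hyp_coef a b) n * Im (polar r t ^ n)%C)).
    apply ex_series_CPS_Im; [now apply radius_incr_1|exact Hz].
  - rewrite E, Im_CPS, Series_incr_1_aux by apply Rmult_0_l.
    now apply Series_ext.
Qed.

Lemma ex_series_atan (r t : R) : 0 <= r < 1 ->
  ex_series (fun n => r ^ S n * (sin (INR (S n) * t) / INR (S n))).
Proof.
  intros Hr. apply ex_series_dominated with (fun n => r ^ n).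
  - intros n. rewrite Rabs_mult, Rabs_pos_eq by (apply pow_le; lra).
    assert (Hn : 1 <= INR (S n)) by (rewrite S_INR; assert (H := pos_INR n); lra).
    assert (H1 : Rabs (sin (INR (S n) * t) / INR (S n)) <= 1).
    { unfold Rdiv. rewrite Rabs_mult, Rabs_inv, (Rabs_pos_eq (INR (S n))) by lra.
      apply Rmult_le_reg_r with (INR (S n)); [lra|].
      rewrite Rmult_assoc, Rinv_l by lra.
      assert (Rabs (sin (INR (S n) * t)) <= 1) by apply Rabs_le, SIN_bound. lra. }
    assert (0 <= r ^ n) by (apply pow_le; lra). simpl pow.
    assert (0 <= r * r ^ n <= r ^ n) by (split; nra). nra.
  - exists (/ (1 - r)). apply is_series_geom. rewrite Rabs_pos_eq; lra.
Qed.

Lemma shifted_Im_defect (r t : R) : 0 <= r < 1 ->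
  ex_series (fun n => (L - der_coef a b n) * r ^ S n * (sin (INR (S n) * t) / INR (S n))) /\
  L * atan (r * sin t / (1 - r * cos t)) - Im (f (polar r t))
  = Series (fun n => (L - der_coef a b n) * r ^ S n * (sin (INR (S n) * t) / INR (S n))).
Proof.
  intros Hr. destruct (shifted_Im_polar r t Hr) as [X E]. rewrite E.
  assert (Y := ex_Rseries_scal_l L _ (ex_series_atan r t Hr)).
  assert (T : forall n, L * (r ^ S n * (sin (INR (S n) * t) / INR (S n)))
       - hyp_coef a b n * r ^ S n * sin (INR (S n) * t)
     = (L - der_coef a b n) * r ^ S n * (sin (INR (S n) * t) / INR (S n))).
  { intros n. unfold der_coef. field. apply not_0_INR. discriminate. }
  split.
  - apply ex_series_ext with (1 := T). now apply ex_Rseries_minus.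
  - rewrite <- atan_sine_series, <- Series_scal_l, <- Series_minus by assumption.
    now apply Series_ext.
Qed.

Lemma der_coef_le_lim (n : nat) : der_coef a b n <= L.
Proof.
  destruct Hab as (Ha & Hb & _).
  exact (is_lim_seq_incr_compare _ _ (der_coef_lim a b Ha Hb) (der_coef_incr a b Hab) n).
Qed.

(** By the telescoping increment bound, [der_coef a b n + M / (n + 1)] decreases; its limit is [L],
    so it never falls below [L]. *)
Lemma der_coef_defect (n : nat) : L - der_coef a b n <= 2 * (a * b) * L / (INR n + 1).
Proof.
  destruct Hab as (Ha & Hb & _). set (M := 2 * (a * b) * L).
  assert (Hlim : is_lim_seq (fun n => der_coef a b n + M * / (INR n + 1)) (L + M * 0)).
  { apply is_lim_seq_plus'; [now apply der_coef_lim|].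
    apply is_lim_seq_mult'; [apply is_lim_seq_const|].
    apply is_lim_seq_ext with (fun n => / INR (S n)); [intros k; now rewrite S_INR|].
    apply (is_lim_seq_incr_1 (fun n => / INR n)).
    apply (is_lim_seq_inv INR p_infty); [apply is_lim_seq_INR|discriminate]. }
  assert (H := is_lim_seq_decr_compare _ _ Hlim).
  assert (H' : L + M * 0 <= der_coef a b n + M * / (INR n + 1)).
  { apply H. intros k. assert (I := der_coef_increment a b Hab L k (der_coef_le_lim k)).
    fold M in I. rewrite S_INR. replace (INR k + 1 + 1) with (INR k + 2) by ring. lra. }
  unfold Rdiv. lra.
Qed.

Lemma shifted_Im_upper (r t : R) : 0 <= r < 1 -> 0 <= t <= PI ->
  Im (f (polar r t)) <= L * atan (r * sin t / (1 - r * cos t)).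
Proof.
  intros Hr Ht. destruct (shifted_Im_defect r t Hr) as [X E].
  enough (0 <= Series (fun n => (L - der_coef a b n) * r ^ S n * (sin (INR (S n) * t) / INR (S n))))
    by lra.
  apply Series_ge_0_of_sums; [exact X|].
  apply (abel_nonneg (fun n => (L - der_coef a b n) * r ^ S n)
           (fun n => sin (INR (S n) * t) / INR (S n))).
  - intros n. assert (H := der_coef_le_lim n). apply Rmult_le_pos; [lra|apply pow_le; lra].
  - intros n. assert (H := der_coef_le_lim (S n)). assert (H' := der_coef_incr a b Hab n).
    assert (0 <= r ^ S n) by (apply pow_le; lra).
    apply Rmult_le_compat; [lra|apply pow_le; lra|lra|].
    simpl pow in *. nra.
  - intros n. now apply fejer_jackson.
Qed.

Lemma shifted_Im_nonneg (r t : R) : 0 <= r < 1 -> 0 <= t <= PI -> 0 <= Im (f (polar r t)).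
Proof.
  intros Hr Ht. destruct (shifted_Im_polar r t Hr) as [X E]. rewrite E.
  destruct (Req_dec t 0) as [->|Ht0].
  { right. rewrite (Series_ext _ (fun _ => 0 * 0)).
    - rewrite Series_scal_l. ring.
    - intros n. rewrite Rmult_0_r, sin_0. ring. }
  assert (Hc : cos t < 1).
  { rewrite <- cos_0. apply cos_decreasing_1; lra. }
  apply (convex_sine_series (fun n => hyp_coef a b n * r ^ S n)); auto.
  - apply sin_ge_0; lra.
  - intros n. assert (H1 := hyp_coef_convex a b Hab n). assert (H2 := hyp_coef_decr a b Hab (S n)).
    assert (H3 := hyp_coef_pos a b Hab (S (S n))).
    set (A0 := hyp_coef a b n) in *. set (A1 := hyp_coef a b (S n)) in *.
    set (A2 := hyp_coef a b (S (S n))) in *.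
    assert (0 <= r ^ S n) by (apply pow_le; lra).
    replace (2 * (A1 * r ^ S (S n))) with (r ^ S n * (2 * A1 * r)) by (simpl pow; ring).
    replace (A0 * r ^ S n + A2 * r ^ S (S (S n))) with (r ^ S n * (A0 + A2 * r ^ 2))
      by (simpl pow; ring).
    apply Rmult_le_compat_l; [assumption|].
    (* Convexity survives the weights [r^(n+1)]: from [A0 >= 2 A1 - A2], the quantity
       [A0 - 2 A1 r + A2 r^2] is at least this product, which is nonnegative because [A2 <= A1]. *)
    assert (0 <= (1 - r) * (2 * A1 - (1 + r) * A2)) by (apply Rmult_le_pos; nra).
    nra.
  - intros n. assert (H2 := hyp_coef_decr a b Hab n). assert (H3 := hyp_coef_pos a b Hab (S n)).
    assert (0 <= r ^ S n) by (apply pow_le; lra).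
    apply Rmult_le_compat; [lra|apply pow_le; lra|exact H2|].
    simpl pow in *. nra.
  - intros n. assert (H3 := hyp_coef_pos a b Hab n).
    apply Rmult_le_pos; [lra|apply pow_le; lra].
  - apply is_lim_seq_le_le with (fun _ => 0) (fun n => r ^ S n).
    + intros n. assert (H3 := hyp_coef_pos a b Hab n). assert (H4 := hyp_coef_le_1 a b Hab n).
      assert (0 <= r ^ S n) by (apply pow_le; lra). split; nra.
    + apply is_lim_seq_const.
    + apply (is_lim_seq_incr_1 (fun n => r ^ n)). apply is_lim_seq_geom. rewrite Rabs_pos_eq; lra.
Qed.

Lemma shifted_conj (z : C) : f (Cconj z) = Cconj (f z).
Proof.
  unfold f. change (Cconj z * CPS (hyp_coef a b) (Cconj z) = Cconj (z * CPS (hyp_coef a b) z))%C.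
  rewrite CPS_conj. apply C_ext; simpl; ring.
Qed.

Lemma shifted_strip (z : C) : unit_disk z -> Rabs (Im (f z)) < L * (PI / 2).
Proof.
  assert (HU : forall w, unit_disk w -> 0 <= Im w -> Rabs (Im (f w)) < L * (PI / 2)).
  { intros w Hw Hi. destruct (polar_upper w Hi) as (t & Ht & E).
    assert (Hr : 0 <= Cmod w < 1) by (split; [apply Cmod_ge_0|exact Hw]).
    rewrite E, Rabs_pos_eq by now apply shifted_Im_nonneg.
    eapply Rle_lt_trans; [now apply shifted_Im_upper|].
    apply Rmult_lt_compat_l; [exact HL|apply atan_bound]. }
  intros Hz. destruct (Rle_or_lt 0 (Im z)) as [Hi|Hi]; [now apply HU|].
  assert (H := HU (Cconj z)). rewrite shifted_conj, !Im_conj, Rabs_Ropp in H. apply H.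
  - unfold unit_disk. now rewrite Cmod_conj.
  - lra.
Qed.

(** Split at a free index [K]. Up to [K], [sin x <= x] bounds each term by [M t]; beyond it,
    [sin <= 1] leaves [M / (n + 1)^2], whose sum telescopes to at most [M / (K + 1)]. The bound is
    independent of [N] and [r]. *)
Lemma sine_error_sum (e : nat -> R) (M r t : R) (K N : nat) :
  0 <= M -> 0 <= r < 1 -> 0 < t -> (forall n, 0 <= e n <= M / (INR n + 1)) ->
  sum_f_R0 (fun n => e n * r ^ S n * (sin (INR (S n) * t) / INR (S n))) N
  <= (INR K + 1) * (M * t) + M / (INR K + 1).
Proof.
  intros HM Hr Ht He.
  set (T := fun n => e n * r ^ S n * (sin (INR (S n) * t) / INR (S n))).
  assert (HT : forall n B, 0 <= B -> sin (INR (S n) * t) <= B ->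
      T n <= M / (INR n + 1) * (B / (INR n + 1))).
  { intros n B HB Hs. unfold T. specialize (He n). rewrite S_INR in *.
    assert (Hn := pos_INR n).
    assert (Hp : 0 <= r ^ S n <= 1).
    { split; [apply pow_le; lra|]. rewrite <- (pow1 (S n)). apply pow_incr. lra. }
    assert (0 <= B / (INR n + 1)) by (apply Rdiv_le_0_compat; lra).
    apply Rle_trans with (e n * r ^ S n * (B / (INR n + 1))).
    - apply Rmult_le_compat_l; [apply Rmult_le_pos; lra|].
      apply Rmult_le_compat_r; [apply Rlt_le, Rinv_0_lt_compat; lra|exact Hs].
    - apply Rmult_le_compat_r; [assumption|]. nra. }
  assert (H1 : forall n, T n <= M * t).
  { intros n. assert (Hn := pos_INR n).
    assert (Hp : 0 < INR (S n) * t) by (apply Rmult_lt_0_compat; [rewrite S_INR|]; lra).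
    eapply Rle_trans; [apply (HT n (INR (S n) * t)); [lra|left; now apply sin_lt_x]|].
    rewrite S_INR. replace (M / (INR n + 1) * ((INR n + 1) * t / (INR n + 1)))
      with (M * t * / (INR n + 1)) by (field; lra).
    rewrite <- (Rmult_1_r (M * t)) at 2. apply Rmult_le_compat_l; [apply Rmult_le_pos; lra|].
    rewrite <- Rinv_1. apply Rinv_le_contravar; lra. }
  assert (HMt : 0 <= M * t) by (apply Rmult_le_pos; lra).
  assert (H2 : forall n, sum_f_R0 T n <= (INR n + 1) * (M * t)).
  { induction n as [|n IH]; [simpl sum_f_R0; specialize (H1 0%nat); simpl INR; lra|].
    rewrite tech5, S_INR. specialize (H1 (S n)). lra. }
  assert (HK := pos_INR K).
  assert (H3 : forall j, sum_f_R0 T (K + j)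
     <= (INR K + 1) * (M * t) + M * (/ (INR K + 1) - / (INR (K + j) + 1))).
  { induction j as [|j IH].
    - rewrite Nat.add_0_r. specialize (H2 K). lra.
    - rewrite Nat.add_succ_r, tech5, S_INR.
      assert (Hn := pos_INR (K + j)). set (n := (K + j)%nat) in *.
      assert (HS := HT (S n) 1 Rle_0_1 (proj2 (SIN_bound _))). rewrite S_INR in HS.
      assert (Hle : M / (INR n + 1 + 1) * (1 / (INR n + 1 + 1))
          <= M * (/ (INR n + 1) - / (INR n + 1 + 1))).
      { replace (M / (INR n + 1 + 1) * (1 / (INR n + 1 + 1)))
          with (M * (/ (INR n + 1 + 1) * / (INR n + 1 + 1))) by (field; lra).
        apply Rmult_le_compat_l; [exact HM|].
        replace (/ (INR n + 1) - / (INR n + 1 + 1)) with (/ (INR n + 1) * / (INR n + 1 + 1))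
          by (field; lra).
        apply Rmult_le_compat_r; [apply Rlt_le, Rinv_0_lt_compat; lra|].
        apply Rinv_le_contravar; lra. }
      lra. }
  assert (HMK : 0 <= M / (INR K + 1)) by (apply Rdiv_le_0_compat; lra).
  destruct (Nat.le_gt_cases N K) as [HN|HN].
  - apply Rle_trans with ((INR N + 1) * (M * t)); [apply H2|].
    apply le_INR in HN. nra.
  - replace N with (K + (N - K))%nat by lia. eapply Rle_trans; [apply H3|].
    assert (0 <= M * / (INR (K + (N - K)) + 1)).
    { apply Rmult_le_pos; [exact HM|]. apply Rlt_le, Rinv_0_lt_compat.
      assert (H := pos_INR (K + (N - K))). lra. }
    unfold Rdiv. lra.
Qed.

(* At [cos t * e^(it)] the argument of [1/(1-z)] is exactly [PI/2 - t]. *)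
Lemma shifted_Im_near_1 (t : R) (K : nat) : 0 < t < PI / 2 ->
  L * (PI / 2 - t) - ((INR K + 1) * (2 * (a * b) * L * t) + 2 * (a * b) * L / (INR K + 1))
  <= Im (f (polar (cos t) t)).
Proof.
  intros Ht. assert (HPI := PI_RGT_0).
  assert (Hc : 0 < cos t) by (apply cos_gt_0; lra).
  assert (Hs : 0 < sin t) by (apply sin_gt_0; lra).
  assert (Hcs := sin2_cos2 t). unfold Rsqr in Hcs.
  assert (Hr : 0 <= cos t < 1) by (split; [lra|]; nra).
  destruct (shifted_Im_defect (cos t) t Hr) as [X E].
  replace (atan (cos t * sin t / (1 - cos t * cos t))) with (PI / 2 - t) in E.
  2:{ replace (cos t * sin t / (1 - cos t * cos t)) with (tan (PI / 2 - t)).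
      - rewrite atan_tan; lra.
      - unfold tan. rewrite sin_shift, cos_shift.
        replace (1 - cos t * cos t) with (sin t * sin t) by lra. field. lra. }
  destruct Hab as (Ha & Hb & _).
  assert (HM : 0 <= 2 * (a * b) * L) by (apply Rmult_le_pos; [nra|lra]).
  assert (B : Series (fun n => (L - der_coef a b n) * cos t ^ S n * (sin (INR (S n) * t) / INR (S n)))
     <= (INR K + 1) * (2 * (a * b) * L * t) + 2 * (a * b) * L / (INR K + 1)).
  { refine (is_lim_seq_le _ _ (Finite _) (Finite _) _ (Series_lim_sum _ X) (is_lim_seq_const _)).
    intros N. apply sine_error_sum; auto; [lra|].
    intros n. split; [assert (H := der_coef_le_lim n); lra|apply der_coef_defect]. }
  lra.
Qed.

Lemma shifted_Im_sup (B : R) : (forall z, unit_disk z -> Im (f z) <= B) -> L * (PI / 2) <= B.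
Proof.
  intros HB. destruct (Rle_or_lt (L * (PI / 2)) B) as [|Hlt]; [assumption|exfalso].
  assert (HPI := PI2_1).
  set (M := 2 * (a * b) * L).
  assert (HM : 0 <= M) by (destruct Hab as (Ha & Hb & _); apply Rmult_le_pos; [nra|lra]).
  set (D := L * (PI / 2) - B).
  (* With [x = 1 / (K + 1)] and [t = x^2] both error terms of [shifted_Im_near_1] equal [M x], and
     [L t <= L x]. The total loss is at most [(L + 2 M) x], so [K] is chosen to make this smaller
     than the gap [D]. *)
  destruct (archimed_cor1 (D / (L + 2 * M))) as (K & HK & HK0).
  { apply Rdiv_lt_0_compat; unfold D; lra. }
  destruct K as [|K]; [lia|]. rewrite S_INR in HK. assert (HKp := pos_INR K).
  set (x := / (INR K + 1)) in *.
  assert (Hx0 : 0 < x) by (apply Rinv_0_lt_compat; lra).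
  assert (Hx1 : x <= 1).
  { unfold x. rewrite <- Rinv_1. apply Rinv_le_contravar; lra. }
  assert (Hx2 : (L + 2 * M) * x < D).
  { apply Rmult_lt_compat_l with (r := L + 2 * M) in HK; [|lra].
    replace ((L + 2 * M) * (D / (L + 2 * M))) with D in HK by (field; lra). exact HK. }
  assert (Hxx : 0 < x * x <= x) by (split; nra).
  assert (H := shifted_Im_near_1 (x * x) K ltac:(lra)). fold M in H.
  change (M / (INR K + 1)) with (M * x) in H.
  assert (Hz : unit_disk (polar (cos (x * x)) (x * x))).
  { apply polar_in_disk. split; [apply cos_ge_0; lra|].
    rewrite <- cos_0. apply cos_decreasing_1; lra. }
  specialize (HB _ Hz).
  replace ((INR K + 1) * (M * (x * x))) with (M * x * ((INR K + 1) * x)) in H by ring.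
  replace ((INR K + 1) * x) with 1 in H by (unfold x; field; lra).
  assert (L * (x * x) <= L * x) by (apply Rmult_le_compat_l; lra).
  unfold D in Hx2. nra.
Qed.

Lemma shifted_lub :
  is_lub_Rbar (fun y : R => exists z : C, unit_disk z /\ y = Im (f z)) (Finite (L * (PI / 2))).
Proof.
  split.
  - intros y (z & Hz & ->). assert (H := shifted_strip z Hz).
    apply Rabs_lt_between in H. change (Im (f z) <= L * (PI / 2)). lra.
  - intros [B| |] HB; simpl.
    + apply shifted_Im_sup. intros z Hz. apply (HB (Im (f z))). now exists z.
    + exact I.
    (* [m_infty] is no upper bound, because the set contains the value at 0. *)
    + apply (HB (Im (f (RtoC 0)))). exists (RtoC 0). split; [|reflexivity].
      unfold unit_disk. rewrite Cmod_0. lra.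
Qed.

Lemma shifted_glb :
  is_glb_Rbar (fun y : R => exists z : C, unit_disk z /\ y = Im (f z)) (Finite (- (L * (PI / 2)))).
Proof.
  split.
  - intros y (z & Hz & ->). assert (H := shifted_strip z Hz).
    apply Rabs_lt_between in H. change (- (L * (PI / 2)) <= Im (f z)). lra.
  - intros [B| |] HB; simpl.
    + assert (H : L * (PI / 2) <= - B); [|lra].
      apply shifted_Im_sup. intros z Hz.
      assert (H : B <= Im (f (Cconj z))).
      { apply (HB (Im (f (Cconj z)))). exists (Cconj z). split; [|reflexivity].
        unfold unit_disk. now rewrite Cmod_conj. }
      rewrite shifted_conj, Im_conj in H. lra.
    + apply (HB (Im (f (RtoC 0)))). exists (RtoC 0). split; [|reflexivity].
      unfold unit_disk. rewrite Cmod_0. lra.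
    + exact I.
Qed.

End Strip.

(** At [a = 1] the product condition reads [b <= 4]; for [a > 1] it is [b <= 4 a / (5 a - 4)]
    multiplied by its positive denominator. *)
Lemma admissible_of_conditions (a b : R) :
  (a = 1 /\ 1 <= b <= 4) \/
  (1 < a /\ a <= b /\ b <= Rmin 3 (Rmin (1 + a) (4 * a / (5 * a - 4)))) ->
  admissible a b.
Proof.
  unfold admissible. intros [[-> Hb]|(Ha & Hb & Hmin)]; [lra|].
  assert (H1 := Rmin_r 3 (Rmin (1 + a) (4 * a / (5 * a - 4)))).
  assert (H2 := Rmin_r (1 + a) (4 * a / (5 * a - 4))).
  assert (H : b <= 4 * a / (5 * a - 4)) by lra.
  repeat split; [lra|lra|].
  apply Rmult_le_compat_r with (r := 5 * a - 4) in H; [|lra].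
  unfold Rdiv in H. rewrite Rmult_assoc, Rinv_l in H by lra. lra.
Qed.

Theorem theorem1p3 :
  forall (a b : R),
  (a = 1 /\ 1 <= b <= 4) \/
  (1 < a /\ a <= b /\ b <= Rmin 3 (Rmin (1 + a) (4 * a / (5 * a - 4)))) ->
  let f := fun z : C => (z * hyp2F1 a b (a + b) z)%C in
  convex_on_disk f /\
  (forall z : C, unit_disk z -> Rabs (Im (f z)) < PI / (2 * Beta a b)) /\
  is_lub_Rbar (fun y : R => exists z : C, unit_disk z /\ y = Im (f z))
    (Finite (PI / (2 * Beta a b))) /\
  is_glb_Rbar (fun y : R => exists z : C, unit_disk z /\ y = Im (f z))
    (Finite (- (PI / (2 * Beta a b)))).
Proof.
  intros a b H f. apply admissible_of_conditions in H.
  assert (HB : 0 < Beta a b) by (destruct H as (Ha & Hb & _); now apply Beta_pos).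
  replace (PI / (2 * Beta a b)) with (/ Beta a b * (PI / 2)) by (field; lra).
  split; [|split; [|split]].
  - now apply shifted_convex.
  - now apply shifted_strip.
  - now apply shifted_lub.
  - now apply shifted_glb.
Qed.
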